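(* Suppose that the domain velocity $\boldsymbol{w}^n$ has the form $(0,0,w^n)$. Let $\phi$ be a function defined on $\Sigma^{n+1}$. (1) If $\delta t$ is sufficiently small so that $$1+\delta t\,\mathrm{tr}\big(\nabla_{\Sigma^n}(\boldsymbol{w}^n)\big)\ge 0\quad\text{on }\Sigma^n,$$ then the ALE scheme is such that $$\int_{\Sigma^{n+1}}\phi\,d\sigma_{\Sigma^{n+1}}-\int_{\Sigma^n}\phi\circ\mathcal A_{n,n+1}\,d\sigma_{\Sigma^n}\ \ge\ \delta t\int_{\Sigma^n}\phi\circ\mathcal A_{n,n+1}\,\mathrm{tr}\big(\nabla_{\Sigma^n}(\boldsymbol{w}^n)\big)\,d\sigma_{\Sigma^n}.$$ (2) Likewise, if $\delta t$ is sufficiently small so that $$1-\delta t\,\mathrm{tr}\big(\nabla_{\Sigma^{n+1}}(\boldsymbol{w}^n\circ\mathcal A_{n,n+1}^{-1})\big)\ge 0\quad\text{on }\Sigma^{n+1},$$ then the ALE scheme is such that $$\int_{\Sigma^{n+1}}\phi\,d\sigma_{\Sigma^{n+1}}-\int_{\Sigma^n}\phi\circ\mathcal A_{n,n+1}\,d\sigma_{\Sigma^n}\ \le\ \delta t\int_{\Sigma^{n+1}}\phi\,\mathrm{tr}\big(\nabla_{\Sigma^{n+1}}(\boldsymbol{w}^n\circ\mathcal A_{n,n+1}^{-1})\big)\,d\sigma_{\Sigma^{n+1}}.$$ (3) Moreover, in both cases, the difference between the two sides of the inequality is of order $\delta t^2$ in the limit $\delta t\to0$.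
   Context: The setting is the Arbitrary Lagrangian Eulerian (ALE) time discretization of a two-fluid flow in a bounded smooth domain $\Omega\subset\mathbb R^3$, with time step $\delta t=t_{n+1}-t_n>0$. At time $t_n$, fluid $i$ ($i=1,2$) occupies the subdomain $\Omega_i^n$ of $\Omega$, and $\Sigma^n=\partial\Omega_1^n\cap\partial\Omega_2^n$ is the interface between the two fluids. Given the domain velocity $\boldsymbol{w}^n$ at time $t_n$, the ALE map is $\mathcal A_{n,n+1}(\boldsymbol{y})=\boldsymbol{y}+\delta t\,\boldsymbol{w}^n(\boldsymbol{y})$. It defines the subdomains at the next time by $\Omega_i^{n+1}=\mathcal A_{n,n+1}(\Omega_i^n)$, $i=1,2$, and hence $\Sigma^{n+1}=\mathcal A_{n,n+1}(\Sigma^n)$. The velocity $\boldsymbol{w}^n$ is such that $\mathcal A_{n,n+1}$ is sufficiently smooth. The measures $\sigma_{\Sigma^n}$ and $\sigma_{\Sigma^{n+1}}$ are the surface measures. For a smooth hypersurface $\Sigma$ with unit normal $\boldsymbol{n}_\Sigma$ and a smooth vector field $\boldsymbol{X}$, the surface gradient is $\nabla_\Sigma\boldsymbol{X}=P_\Sigma\nabla\boldsymbol{X}$, where $P_\Sigma=\mathrm{Id}-\boldsymbol{n}_\Sigma\otimes\boldsymbol{n}_\Sigma$ is the orthogonal projector onto the tangent space to $\Sigma$. Thus $\mathrm{tr}(\nabla_\Sigma\boldsymbol{X})=\mathrm{div}\,\boldsymbol{X}-(\nabla\boldsymbol{X}\,\boldsymbol{n}_\Sigma)\cdot\boldsymbol{n}_\Sigma$,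 and it depends only on the values of $\boldsymbol{X}$ on $\Sigma$.
   Formalization: Inequalities (1) and (2) are stated for φ ≥ 0 on Σ^{n+1} (they fail for e.g. φ = −1); φ is assumed integrable on Σ^{n+1}, and in (3), where φ may depend on δt and have any sign, ∫|φ|dσ_{Σ^{n+1}} is assumed bounded as δt→0. *)

(* Defs.v *)
From HB Require Import structures.
From mathcomp Require Import all_boot all_order all_algebra.
From mathcomp Require Import all_classical all_reals all_analysis.

Set Implicit Arguments.
Unset Strict Implicit.
Unset Printing Implicit Defensive.

Import Order.TTheory GRing.Theory Num.Theory.
Import numFieldNormedType.Exports.

Local Open Scope classical_set_scope.
Local Open Scope ring_scope.

(* Euclidean inner product; the norm `|_| on 'rV[R]_3 is the sup norm. *)
Definition dot (R : realType) (u v : 'rV[R]_3) : R := (u *m v^T) 0 0.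

Definition boundary (T : topologicalType) (A : set T) : set T :=
  closure A `\` interior A.

Definition C1_on (R : realType) (V W : normedModType R)
    (U : set V) (f : V -> W) : Prop :=
  forall x, U x -> differentiable f x /\
    forall v, {for x, continuous (fun y => 'D_v f y)}.

(* f restricts to a C^1-diffeomorphism from the open set D onto the open set
   f(D); pinv D f is the inverse map f(D) -> D. *)
Definition C1_diffeo (R : realType) (D : set 'rV[R]_3)
    (f : 'rV[R]_3 -> 'rV[R]_3) : Prop :=
  [/\ open D, open (f @` D), {in D &, injective f},
      C1_on D f & C1_on (f @` D) (pinv D f)].

(* Bounded domain with C^1 boundary: near each boundary point, Omega is a
   sublevel set of a C^1 function with nonzero differential. *)
Definition bounded_smooth_domain (R : realType) (Omega : set 'rV[R]_3) : Prop :=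
  [/\ open Omega, connected Omega, bounded_set Omega &
    forall p, boundary Omega p ->
      exists (V : set 'rV[R]_3) (g : 'rV[R]_3 -> R),
        [/\ open V, V p, C1_on V g, (exists v, 'D_v g p != 0) &
            Omega `&` V = [set x | g x < 0] `&` V]].

Definition interface (R : realType) (Omega1 Omega2 : set 'rV[R]_3)
    : set 'rV[R]_3 :=
  boundary Omega1 `&` boundary Omega2.

(* Hypersurfaces of R^3 may have a boundary curve (contact line): they are
   modelled on the plane R * R or on a closed half-plane. *)
Definition model_region (R : realType) (H : set (R * R)) : Prop :=
  H = setT \/ H = [set u | 0 <= u.1].

(* E G - F^2, the determinant of the first fundamental form of psi; it equals
   |d_1 psi x d_2 psi|^2. *)
Definition gram (R : realType) (psi : R * R -> 'rV[R]_3) (u : R * R) : R :=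
  let d1 := 'D_(1, 0) psi u in let d2 := 'D_(0, 1) psi u in
  dot d1 d1 * dot d2 d2 - dot d1 d2 ^+ 2.

(* psi is a regular C^1 parametrization of the relatively open part S `&` V of
   S by U `&` H, and a homeomorphism between the two. *)
Definition is_chart (R : realType) (S : set 'rV[R]_3) (H U : set (R * R))
    (V : set 'rV[R]_3) (psi : R * R -> 'rV[R]_3) : Prop :=
  [/\ model_region H, open U /\ open V,
      C1_on U psi /\ (forall u, U u -> 0 < gram psi u),
      {in U `&` H &, injective psi} /\ psi @` (U `&` H) = S `&` V &
      {within S `&` V, continuous (pinv (U `&` H) psi)}].

Definition smooth_hypersurface (R : realType) (S : set 'rV[R]_3) : Prop :=
  forall p, S p -> exists H U V psi, is_chart S H U V psi /\ V p.

Definition unit_normal (R : realType) (S : set 'rV[R]_3)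
    (n : 'rV[R]_3 -> 'rV[R]_3) : Prop :=
  (forall p, S p -> dot (n p) (n p) = 1) /\
  forall H U V psi, is_chart S H U V psi -> forall u, (U `&` H) u ->
    dot (n (psi u)) ('D_(1, 0) psi u) = 0 /\
    dot (n (psi u)) ('D_(0, 1) psi u) = 0.

(* R^3 with its Borel sigma-algebra. *)
Definition borel3 (R : realType) := g_sigma_algebraType (@open 'rV[R]_3).

(* sigma is the surface measure of S: it is carried by S and is given in every
   chart by the area element sqrt (E G - F^2) du1 du2. *)
Definition surface_measure (R : realType) (S : set 'rV[R]_3)
    (sigma : {measure set (borel3 R) -> \bar R}) : Prop :=
  sigma (~` S) = 0%E /\
  forall H U V psi, is_chart S H U V psi ->
    forall B : set (borel3 R), measurable B ->
      sigma (B `&` V) =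
      (\int[lebesgue_measure \x lebesgue_measure]_(u in
         U `&` H `&` psi @^-1` B) (Num.sqrt (gram psi u))%:E)%E.

(* P_S \nabla X with P_S = Id - n (x) n. As 'J X p acts on row vectors,
   ('J X p) i j = d_i X_j. *)
Definition surface_gradient (R : realType) (n X : 'rV[R]_3 -> 'rV[R]_3)
    (p : 'rV[R]_3) : 'M[R]_3 :=
  (1%:M - (n p)^T *m n p) *m 'J X p.

Definition ale_map (R : realType) (W : 'rV[R]_3 -> 'rV[R]_3) (dt : R)
    (y : 'rV[R]_3) : 'rV[R]_3 := y + dt *: W y.

Definition next_interface (R : realType) (Omega1 Omega2 : set 'rV[R]_3)
    (W : 'rV[R]_3 -> 'rV[R]_3) (dt : R) : set 'rV[R]_3 :=
  interface (ale_map W dt @` Omega1) (ale_map W dt @` Omega2).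

(* W o A^{-1}, where A = ale_map W dt is inverted on D. *)
Definition transported_velocity (R : realType) (D : set 'rV[R]_3)
    (W : 'rV[R]_3 -> 'rV[R]_3) (dt : R) : 'rV[R]_3 -> 'rV[R]_3 :=
  W \o pinv D (ale_map W dt).

(* Main.v *)
Require Import Defs.
From HB Require Import structures.
From mathcomp Require Import all_boot all_order all_algebra.
From mathcomp Require Import all_classical all_reals all_analysis.
From mathcomp Require Import measurable_realfun ring lra.

Set Implicit Arguments.
Unset Strict Implicit.
Unset Printing Implicit Defensive.

Import Order.TTheory GRing.Theory Num.Theory.
Import numFieldNormedType.Exports.

Local Open Scope classical_set_scope.
Local Open Scope ring_scope.

(** Write g for the gradient of w, e for the third basis vector and t for the
    time step. The differential of A = id + t w e sends a tangent vector a to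
    a + t (a . g) e, hence the normal N = d_1 psi x d_2 psi of a chart psi to
    N + t (g_3 N - N_3 g), the normal of the chart A o psi. The ratio J of the
    area elements is thus the length of m = n + t (g_3 n - n_3 g), and
    m . n = 1 + t tr (surface gradient), whence (1) by Cauchy-Schwarz; the
    component of m orthogonal to n is O(t), so that J = m . n + O(t^2).
    The inverse of A is again a vertical motion, with time step - t and
    velocity W o A^-1: exchanging the two interfaces gives (2) and the second
    half of (3). *)

(** * Measurability *)

(** Surface measures are known only through charts, the new interface only as an intersection of
    boundaries, and the normals are arbitrary unit fields. Hence three transfers: [A] maps
    boundaries to boundaries, because the closures of the subdomains are compact in [D]; it maps
    charts to charts, so that both integrals live on the same region of the plane; and the area
    ratio is measurable as a quotient of Gram determinants. In (1) and (2) the time step is fixed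
    and may be large. Integrability of phi o A then rests on the invertibility of [A]: it excludes 1
    + t g_3 = 0, and compactness keeps J away from 0. In (3) the constants must not depend on t. The
    gradient of W is bounded on the fixed compact interface; that of W o A^-1 varies with t and is
    compared with the former by differentiating B o A = id. *)

Section density.
Import HBNNSimple.

(** Indicators, then simple functions, then monotone convergence. The measure [nu] is described only
    on subsets of [C], as a surface measure is inside one chart, so it is not globally an image
    measure. *)
Lemma ge0_integral_density (d1 d2 : measure_display) (X : measurableType d1)
    (Y : measurableType d2) (R : realType) (mu : {measure set X -> \bar R})
    (nu : {measure set Y -> \bar R}) (P : set X) (C : set Y) (psi : X -> Y)
    (rho : X -> R) (f : Y -> \bar R) :
  measurable P -> measurable C -> measurable_fun P psi ->
  measurable_fun P rho -> (forall x, P x -> 0 <= rho x) ->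
  P `<=` psi @^-1` C ->
  (forall B, measurable B -> B `<=` C ->
     nu B = \int[mu]_(x in P `&` psi @^-1` B) (rho x)%:E)%E ->
  measurable_fun C f -> (forall y, C y -> 0 <= f y)%E ->
  (\int[nu]_(y in C) f y = \int[mu]_(x in P) (f (psi x) * (rho x)%:E))%E.
Proof.
move=> mP mC mpsi mrho rho0 PC nuE mf f0.
pose f_ := nnsfun_approx mC mf.
have mf_psi n : measurable_fun P (EFin \o (fun x => f_ n (psi x))).
  by apply/measurable_EFinP; apply: measurableT_comp.
transitivity (limn (fun n => \int[nu]_(x in C) (f_ n x)%:E))%E.
  rewrite -monotone_convergence//.
  - apply: eq_integral => y /[!inE] yC; apply/esym/cvg_lim => //.
    exact: cvg_nnsfun_approx.
  - by move=> n; exact/measurable_EFinP/measurable_funTS.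
  - by move=> n y _; rewrite lee_fin.
  - by move=> y _ m n mn; rewrite lee_fin; exact/lefP/nd_nnsfun_approx.
rewrite [X in limn X](_ : _ =
    (fun n => \int[mu]_(x in P) ((f_ n (psi x))%:E * (rho x)%:E)))%E.
  rewrite -monotone_convergence//.
  - apply: eq_integral => x /[!inE] Px; apply/cvg_lim => //.
    apply: cvgeZr => //; apply: cvg_nnsfun_approx => //; exact: PC.
  - move=> n; apply: emeasurable_funM; first exact: mf_psi.
    exact/measurable_EFinP.
  - by move=> n x Px; rewrite -EFinM lee_fin mulr_ge0// rho0.
  - move=> x Px m n mn; rewrite -!EFinM lee_fin ler_wpM2r ?rho0//.
    exact/lefP/nd_nnsfun_approx.
apply/funext => n.
have mlev r : measurable (f_ n @^-1` [set r]) by [].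
transitivity (\sum_(k \in range (f_ n))
    \int[nu]_(x in C) (k * \1_(f_ n @^-1` [set k]) x)%:E)%E.
  under eq_integral do rewrite fimfunE -fsumEFin//.
  rewrite ge0_integral_fsum//.
  - by move=> y; exact/measurable_EFinP/measurable_funM.
  - by move=> y x _; rewrite nnfun_muleindic_ge0.
transitivity (\sum_(k \in range (f_ n))
    \int[mu]_(x in P) (k * \1_(f_ n @^-1` [set k]) (psi x) * rho x)%:E)%E;
    last first.
  rewrite -ge0_integral_fsum//.
  - apply: eq_integral => x _; rewrite [in RHS](fimfunE (f_ n)) -EFinM.
    by rewrite fsumEFin// -mulr_fsuml.
  - move=> r; apply/measurable_EFinP/measurable_funM => //.
    by apply: measurable_funM => //; apply: measurableT_comp.
  - move=> r x Px; rewrite EFinM mule_ge0 ?lee_fin ?rho0//.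
    by have := nnfun_muleindic_ge0 (f_ n) r (psi x); rewrite lee_fin.
apply: eq_fsbigr => r _; rewrite integralZl_indic_nnsfun// integral_indic//=.
(* The constant [r] leaves the integral only if it is nonnegative; a negative level of a nonnegative
   simple function is empty. *)
case: (ltP r 0) => [r0|r0].
  rewrite preimage_nnfun0// set0I measure0 mule0.
  rewrite integral0_eq// => x Px; by rewrite indicE in_set0 mulr0 mul0r.
rewrite nuE; [|exact: measurableI|by []].
under [RHS]eq_integral do rewrite -mulrA EFinM.
rewrite ge0_integralZl//; last 2 first.
  - apply/measurable_EFinP/measurable_funM => //.
    by apply: measurableT_comp.
  - by move=> x Px; rewrite lee_fin mulr_ge0// rho0.
congr (_ * _)%E.
rewrite preimage_setI setIA (setIAC P) (setIidl PC)//.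
rewrite integral_mkcondr; apply: eq_integral => x _.
rewrite /patch indicE.
rewrite -[psi x \in _]/(x \in psi @^-1` (f_ n @^-1` [set r])).
by case: (x \in _); rewrite ?mul1r ?mul0r.
Qed.

End density.

Lemma within_continuous_preimage (T S : topologicalType) (A : set T)
    (f : T -> S) (O : set S) :
  {within A, continuous f} -> open O ->
  exists2 V, open V & A `&` f @^-1` O = A `&` V.
Proof.
move=> /continuousP cf /cf /open_subspaceP[V oV VA].
by exists V => //; rewrite setIC -VA setIC.
Qed.

Local Notation plane R := (measurableTypeR R * measurableTypeR R)%type.

(** The sigma-algebra here is the product one: an open set is the countable union of the rational
    boxes that it contains. *)
Lemma open_measurable_plane (R : realType) (U : set (R * R)) :
  open U -> measurable (U : set (plane R)).
Proof.
move=> oU.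
pose box (q : rat * rat * (rat * rat)) : set (R * R) :=
  `]ratr q.1.1, ratr q.1.2[%classic `*` `]ratr q.2.1, ratr q.2.2[%classic.
have -> : U = \bigcup_(q in [set q | box q `<=` U]) box q.
  apply/seteqP; split=> [[x y] Uxy|u [q /= + bu]]; last exact.
  have /nbhs_ballP[e e0 eU] := open_nbhs_nbhs (conj oU Uxy).
  have [p1] := @rat_in_itvoo R (x - e) x ltac:(by rewrite ltrBlDr ltrDl).
  have [q1] := @rat_in_itvoo R x (x + e) ltac:(by rewrite ltrDl).
  have [p2] := @rat_in_itvoo R (y - e) y ltac:(by rewrite ltrBlDr ltrDl).
  have [q2] := @rat_in_itvoo R y (y + e) ltac:(by rewrite ltrDl).
  rewrite !in_itv/= => /andP[a1 a2] /andP[b1 b2] /andP[c1 c2] /andP[d1 d2].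
  exists (p1, q1, (p2, q2)); last by split; rewrite /= in_itv/= ?a1 ?b2 ?c1 ?d2.
  move=> [x' y'] [/=]; rewrite !in_itv/= => /andP[h1 h2] /andP[k1 k2].
  apply: eU; split; rewrite /= /ball/= ltr_norml; apply/andP; split; lra.
rewrite bigcup_mkcond; apply: countable_bigcupT_measurable => // q.
case: ifPn => // _.
by apply: measurableX; exact: measurable_itv.
Qed.

Lemma measurable_plane_preimage (R : realType) (T : topologicalType)
    (A : set (R * R)) (f : R * R -> T) (O : set T) :
  measurable (A : set (plane R)) ->
  {within A, continuous f} -> open O ->
  measurable (A `&` f @^-1` O : set (plane R)).
Proof.
move=> mA cf oO; have [V oV ->] := within_continuous_preimage cf oO.
by apply: measurableI => //; exact: open_measurable_plane.
Qed.

Lemma open_measurable_borel3 (R : realType) (U : set 'rV[R]_3) :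
  open U -> measurable (U : set (borel3 R)).
Proof. by move=> oU; exact: sub_sigma_algebra. Qed.

Lemma measurable_borel3_preimage (R : realType) (T : topologicalType)
    (A : set 'rV[R]_3) (f : 'rV[R]_3 -> T) (O : set T) :
  measurable (A : set (borel3 R)) -> {within A, continuous f} -> open O ->
  measurable (A `&` f @^-1` O : set (borel3 R)).
Proof.
move=> mA cf oO; have [V oV ->] := within_continuous_preimage cf oO.
by apply: measurableI => //; exact: open_measurable_borel3.
Qed.

Lemma measurable_fun_borel3 (d : measure_display) (X : measurableType d)
    (R : realType) (A : set X) (f : X -> 'rV[R]_3) :
  (forall O, open O -> measurable (A `&` f @^-1` O)) ->
  measurable_fun A (f : X -> borel3 R).
Proof.
move=> mf.
apply: (@measurability _ _ _ (borel3 R) _ _ (@open 'rV[R]_3)) => //.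
by move=> _ [G oG <-]; exact: mf.
Qed.

Lemma measurable_fun_open (d : measure_display) (X : measurableType d)
    (R : realType) (A : set X) (f : X -> R) :
  (forall O, open O -> measurable (A `&` f @^-1` O)) -> measurable_fun A f.
Proof.
move=> mf; apply: (measurability _ (RGenOpens.measurableE R)).
by move=> _ [_ [a [b ->] <-]]; apply: mf; exact: interval_open.
Qed.

Lemma model_region_measurable (R : realType) (H : set (R * R)) :
  model_region H ->
  measurable (H : set (plane R)).
Proof.
move=> [->|->]; first exact: measurableT.
rewrite (_ : [set _ | _] = `[0, +oo[%classic `*` setT).
  by apply: measurableX => //; exact: measurable_itv.
by apply/seteqP; split=> u /=; rewrite in_itv/= andbT // => -[].
Qed.

(** * Area distortion of a vertical shear *)

Lemma dotE (R : realType) (u v : 'rV[R]_3) :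
  dot u v = u 0 0 * v 0 0 + u 0 1 * v 0 1 + u 0 2 * v 0 2.
Proof.
rewrite /dot mxE !big_ord_recl big_ord0 addr0 !mxE addrA.
by do ! congr (_ + _); congr (u _ _ * v _ _); apply/val_inj.
Qed.

Lemma cross_parallel (R : realType) (a0 a1 a2 b0 b1 b2 n0 n1 n2 : R) :
  n0 * n0 + n1 * n1 + n2 * n2 = 1 -> n0 * a0 + n1 * a1 + n2 * a2 = 0 ->
  n0 * b0 + n1 * b1 + n2 * b2 = 0 ->
  exists l, [/\ a1 * b2 - a2 * b1 = l * n0, a2 * b0 - a0 * b2 = l * n1 &
                a0 * b1 - a1 * b0 = l * n2].
Proof.
move=> nn na nb.
(* The triple product n . (a x b). Each component of a x b - l n is then a combination of 1 - n . n,
   n . a and n . b. *)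
exists (n0 * (a1 * b2 - a2 * b1) + n1 * (a2 * b0 - a0 * b2)
        + n2 * (a0 * b1 - a1 * b0)).
split; apply/eqP; rewrite -subr_eq0; apply/eqP.
- transitivity ((a1 * b2 - a2 * b1) * (1 - (n0 * n0 + n1 * n1 + n2 * n2))
   + (n1 * b2 - n2 * b1) * (n0 * a0 + n1 * a1 + n2 * a2)
   - (n1 * a2 - n2 * a1) * (n0 * b0 + n1 * b1 + n2 * b2)); first by ring.
  by rewrite nn na nb; ring.
- transitivity ((a2 * b0 - a0 * b2) * (1 - (n0 * n0 + n1 * n1 + n2 * n2))
   + (n2 * b0 - n0 * b2) * (n0 * a0 + n1 * a1 + n2 * a2)
   - (n2 * a0 - n0 * a2) * (n0 * b0 + n1 * b1 + n2 * b2)); first by ring.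
  by rewrite nn na nb; ring.
- transitivity ((a0 * b1 - a1 * b0) * (1 - (n0 * n0 + n1 * n1 + n2 * n2))
   + (n0 * b1 - n1 * b0) * (n0 * a0 + n1 * a1 + n2 * a2)
   - (n0 * a1 - n1 * a0) * (n0 * b0 + n1 * b1 + n2 * b2)); first by ring.
  by rewrite nn na nb; ring.
Qed.

(* The image of the unit normal n, up to a positive factor that depends only on
   the chart, under id + t w e_3, where g is the gradient of w. *)
Definition conormal (R : realType) (t : R) (n g : 'rV[R]_3) : 'rV[R]_3 :=
  n + t *: (g 0 2 *: n - n 0 2 *: g).

Definition shear (R : realType) (t : R) (g v : 'rV[R]_3) : 'rV[R]_3 :=
  v + (t * dot v g) *: delta_mx 0 2.

(** By Lagrange's identity both Gram determinants are squared lengths of cross products. Since a x b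
    = l n, the cross product of the sheared vectors is l times the conormal. The sign of [n] is
    irrelevant. *)
Lemma gram_shear (R : realType) (t : R) (n g a b : 'rV[R]_3) :
  dot n n = 1 -> dot n a = 0 -> dot n b = 0 ->
  dot (shear t g a) (shear t g a) * dot (shear t g b) (shear t g b)
    - dot (shear t g a) (shear t g b) ^+ 2
  = (dot a a * dot b b - dot a b ^+ 2)
    * dot (conormal t n g) (conormal t n g).
Proof.
rewrite !dotE !mxE /= !mulr0 !mulr1 !addr0 !dotE.
move: (n 0 0) (n 0 1) (n 0 2) (a 0 0) (a 0 1) (a 0 2) (b 0 0) (b 0 1) (b 0 2)
  (g 0 0) (g 0 1) (g 0 2) => n0 n1 n2 a0 a1 a2 b0 b1 b2 g0 g1 g2 nn na nb.
have [l [N0 N1 N2]] := cross_parallel nn na nb.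
(* The third component of the cross product is unchanged: its terms in t cancel. *)
transitivity (
  ((a1 * b2 - a2 * b1) + t * (g2 * (a1 * b2 - a2 * b1)
     - (a0 * b1 - a1 * b0) * g0)) ^+ 2
  + ((a2 * b0 - a0 * b2) + t * (g2 * (a2 * b0 - a0 * b2)
     - (a0 * b1 - a1 * b0) * g1)) ^+ 2
  + (a0 * b1 - a1 * b0) ^+ 2); first by ring.
transitivity (((a1 * b2 - a2 * b1) ^+ 2 + (a2 * b0 - a0 * b2) ^+ 2
  + (a0 * b1 - a1 * b0) ^+ 2) *
  ((n0 + t * (g2 * n0 - n2 * g0)) ^+ 2 + (n1 + t * (g2 * n1 - n2 * g1)) ^+ 2
   + n2 ^+ 2)); last by ring.
rewrite N0 N1 N2.
transitivity (l ^+ 2 * (n0 * n0 + n1 * n1 + n2 * n2) *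
  ((n0 + t * (g2 * n0 - n2 * g0)) ^+ 2 + (n1 + t * (g2 * n1 - n2 * g1)) ^+ 2
   + n2 ^+ 2)); last by ring.
by rewrite nn; ring.
Qed.

Lemma dot_conormal (R : realType) (t : R) (n g : 'rV[R]_3) : dot n n = 1 ->
  dot n (conormal t n g) = 1 + t * (g 0 2 - n 0 2 * dot n g).
Proof.
rewrite !dotE !mxE /=.
move: (n 0 0) (n 0 1) (n 0 2) (g 0 0) (g 0 1) (g 0 2)
  => n0 n1 n2 g0 g1 g2 nn.
transitivity ((n0 * n0 + n1 * n1 + n2 * n2) * (1 + t * g2)
  - t * n2 * (n0 * g0 + n1 * g1 + n2 * g2)); first by ring.
by rewrite nn; ring.
Qed.

Lemma cauchy_schwarz3 (R : realType) (u v : 'rV[R]_3) :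
  dot u v ^+ 2 <= dot u u * dot v v.
Proof.
rewrite !dotE -subr_ge0.
set u0 := u 0 0; set u1 := u 0 1; set u2 := u 0 2.
set v0 := v 0 0; set v1 := v 0 1; set v2 := v 0 2.
rewrite (_ : _ - _ = (u0 * v1 - u1 * v0) ^+ 2 + (u1 * v2 - u2 * v1) ^+ 2
  + (u0 * v2 - u2 * v0) ^+ 2); last by ring.
by rewrite !addr_ge0// sqr_ge0.
Qed.

Lemma conormal_bound (R : realType) (t G : R) (n g : 'rV[R]_3) :
  dot n n = 1 -> dot g g <= G ^+ 2 -> 0 <= G ->
  let T := g 0 2 - n 0 2 * dot n g in let m := conormal t n g in
  [/\ `|T| <= 2 * G, (1 + t * T) ^+ 2 <= dot m m &
      dot m m <= (1 + t * T) ^+ 2 + t ^+ 2 * (4 * G ^+ 2)].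
Proof.
move=> nn gG G0 T m.
have ng : dot n g ^+ 2 <= G ^+ 2.
  by rewrite (le_trans (cauchy_schwarz3 n g))// nn mul1r.
have [n2 g2] : n 0 2 ^+ 2 <= 1 /\ g 0 2 ^+ 2 <= G ^+ 2.
  split; [rewrite -nn|apply: le_trans gG]; rewrite dotE -!expr2;
  by rewrite lerDr addr_ge0// sqr_ge0.
have n2' : `|n 0 2| <= 1 by rewrite -(expr_le1 (n := 2))// real_normK ?num_real.
have ng' : `|dot n g| <= G by rewrite -ler_sqr ?nnegrE// real_normK ?num_real.
have g2' : `|g 0 2| <= G by rewrite -ler_sqr ?nnegrE// real_normK ?num_real.
have TG : `|T| <= 2 * G.
  rewrite (le_trans (ler_normB _ _))// normrM mulr_natl mulr2n lerD//.
  by rewrite -[G]mul1r ler_pM.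
split => //.
  by rewrite -dot_conormal// (le_trans (cauchy_schwarz3 _ _))// nn mul1r.
(* The bracket is |g_3 n - n_3 g|^2 - T^2, the squared length of the part orthogonal to n. Its first
   three terms are at most G^2, 2 G^2 and G^2, whence the constant 4. *)
have -> : dot m m = (1 + t * T) ^+ 2 + t ^+ 2 *
    (g 0 2 ^+ 2 - 2 * g 0 2 * n 0 2 * dot n g + n 0 2 ^+ 2 * dot g g - T ^+ 2).
  rewrite /m /T; move: nn; rewrite !dotE !mxE /=.
  move: (n 0 0) (n 0 1) (n 0 2) (g 0 0) (g 0 1) (g 0 2)
    => n0 n1 n2x g0 g1 g2x nn.
  transitivity ((n0 * n0 + n1 * n1 + n2x * n2x) * (1 + t * g2x) ^+ 2
   - 2 * (1 + t * g2x) * t * n2x * (n0 * g0 + n1 * g1 + n2x * g2x)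
   + t ^+ 2 * n2x ^+ 2 * (g0 * g0 + g1 * g1 + g2x * g2x)); first by ring.
  by rewrite nn; ring.
rewrite lerD2l ler_wpM2l ?sqr_ge0//.
have h1 : - (2 * g 0 2 * n 0 2 * dot n g) <= 2 * G ^+ 2.
  rewrite (le_trans (ler_norm _))// normrN !normrM ger0_norm// -!mulrA.
  rewrite ler_wpM2l// expr2 ler_pM ?mulr_ge0// -[leRHS]mul1r ler_pM//.
have h2 : n 0 2 ^+ 2 * dot g g <= 1 * G ^+ 2.
  by rewrite ler_pM ?sqr_ge0// dotE -!expr2 !addr_ge0// sqr_ge0.
have h3 : 0 <= T ^+ 2 by exact: sqr_ge0.
lra.
Qed.

(** Factor y - x^2 as (sqrt y - x) (sqrt y + x): both terms of the second factor are at least 1/2,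
    so it is at least 1. *)
Lemma sqrt_estimate (R : realType) (x y q : R) :
  2^-1 <= x -> x ^+ 2 <= y -> y <= x ^+ 2 + q -> `|Num.sqrt y - x| <= q.
Proof.
move=> x2 xy yq.
have x0 : 0 <= x by lra.
have y0 : 0 <= y by rewrite (le_trans _ xy)// sqr_ge0.
have s2 : Num.sqrt y ^+ 2 = y by rewrite sqr_sqrtr.
have xs : x <= Num.sqrt y by rewrite -ler_sqr ?nnegrE ?sqrtr_ge0// s2.
rewrite ger0_norm ?subr_ge0//.
have : (Num.sqrt y - x) * (Num.sqrt y + x) <= q.
  rewrite (_ : _ * _ = Num.sqrt y ^+ 2 - x ^+ 2); last by ring.
  by rewrite s2 lerBlDl.
apply: le_trans; rewrite -[leLHS]mulr1 ler_wpM2l ?subr_ge0//; lra.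
Qed.

(** * Differential calculus *)

Lemma C1_on_continuous (R : realType) (V W : normedModType R) (U : set V)
    (f : V -> W) (x : V) : C1_on U f -> U x -> {for x, continuous f}.
Proof. by move=> cf /cf[df _]; exact: differentiable_continuous. Qed.

Lemma C1_on_open_preimage (R : realType) (V W : normedModType R) (U : set V)
    (f : V -> W) (O : set W) :
  open U -> C1_on U f -> open O -> open (U `&` f @^-1` O).
Proof.
move=> oU cf oO; rewrite openE => x [Ux Ofx]; apply: filterI.
  exact: open_nbhs_nbhs.
by apply: (C1_on_continuous cf Ux); exact: open_nbhs_nbhs.
Qed.

Lemma C1_on_subset (R : realType) (V W : normedModType R) (U U' : set V)
    (f : V -> W) : U' `<=` U -> C1_on U f -> C1_on U' f.
Proof. by move=> UU' cf x /UU'/cf. Qed.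

(** [C1_on] gives continuity of derivatives in fixed directions only. For the composition, the
    moving direction ['D_v f x] is therefore decomposed on the canonical basis. *)
Lemma derive_comp_rV (R : realType) (V W : normedModType R)
    (f : V -> 'rV[R]_3) (g : 'rV[R]_3 -> W) (x v : V) :
  differentiable f x -> differentiable g (f x) ->
  'D_v (g \o f) x = \sum_(j < 3) ('D_v f x) 0 j *: 'D_(delta_mx 0 j) g (f x).
Proof.
move=> df dg; rewrite deriveE; last exact: differentiable_comp.
have -> : 'd (g \o f) x v = 'd g (f x) ('D_v f x).
  by rewrite deriveE// diff_comp.
rewrite {1}[X in 'd g _ X]row_sum_delta linear_sum; apply: eq_bigr => j _.
by rewrite linearZ/= -deriveE.
Qed.

Lemma C1_on_comp (R : realType) (V W : normedModType R) (U : set V)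
    (D : set 'rV[R]_3) (f : V -> 'rV[R]_3) (g : 'rV[R]_3 -> W) :
  open U -> (forall x, U x -> D (f x)) -> C1_on U f -> C1_on D g ->
  C1_on U (g \o f).
Proof.
move=> oU UD cf cg x Ux; have [dfx cfx] := cf _ Ux.
have [dgx cgx] := cg _ (UD _ Ux).
split=> [|v]; first exact: differentiable_comp.
have E y : U y -> 'D_v (g \o f) y =
    \sum_(j < 3) ('D_v f y) 0 j *: 'D_(delta_mx 0 j) g (f y).
  move=> Uy; apply: derive_comp_rV; first by have [] := cf _ Uy.
  by have [] := cg _ (UD _ Uy).
rewrite /prop_for /continuous_at E//.
apply: cvg_trans.
  apply: near_eq_cvg; near=> y; apply/esym/E; near: y.
  exact: open_nbhs_nbhs.
apply: cvg_big => [|j _]; first exact: add_continuous.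
apply: cvgZ.
  apply: (cvg_comp _ (fun M : 'rV[R]_3 => M 0 j) (cfx v)).
  exact: coord_continuous.
apply: (cvg_comp _ ('D_(delta_mx 0 j) g)); last exact: cgx.
exact: differentiable_continuous.
Unshelve. all: by end_near. Qed.

Section vertical.
Context (R : realType) (D : set 'rV[R]_3) (W : 'rV[R]_3 -> 'rV[R]_3).
Hypotheses (oD : open D) (dW : forall x, D x -> differentiable W x).
Hypothesis W_vert : forall x, D x -> W x 0 0 = 0 /\ W x 0 1 = 0.

(** The gradient of the vertical component, read off the field itself so that it applies to [W \o B]
    as well. *)
Definition vgrad (x : 'rV[R]_3) : 'rV[R]_3 := \row_i 'J W x i 2.

Lemma jacobian_vertical x i j : D x ->
  'J W x i j = if j == 2 then vgrad x 0 i else 0.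
Proof.
move=> Dx; case: ifPn => [/eqP->|j2]; first by rewrite [RHS]mxE.
have -> : 'J W x i j = (delta_mx (0 : 'I_1) i *m 'J W x) 0 j.
  by rewrite -rowE [RHS]mxE.
rewrite -deriveEjacobian; last exact: dW.
rewrite derive_mx; last by apply: diff_derivable; exact: dW.
(* A horizontal component vanishes on the open set [D], hence near [x], so its derivative is that of
   the constant 0. *)
rewrite mxE -(@derive_cst R _ _ (0 : R) x (delta_mx 0 i)).
apply: near_eq_derive; near=> y.
have /W_vert[W0 W1] : D y by near: y; exact: open_nbhs_nbhs.
case: j j2 => [[|[|[|//]]] jlt] // _.
  by rewrite -[RHS]W0; congr (W y _ _); apply/val_inj.
by rewrite -[RHS]W1; congr (W y _ _); apply/val_inj.
Unshelve. all: by end_near. Qed.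

Lemma derive_vertical x v : D x ->
  'D_v W x = (dot v (vgrad x)) *: delta_mx 0 2.
Proof.
move=> Dx; rewrite deriveEjacobian; last exact: dW.
apply/rowP => j; rewrite mxE [RHS]mxE [X in _ * X]mxE eqxx/=.
under eq_bigr do rewrite jacobian_vertical//.
case: eqVneq => _; last by rewrite mulr0 big1// => *; rewrite mulr0.
by rewrite mulr1 /dot mxE; apply: eq_bigr => i _; rewrite [in RHS]mxE.
Qed.

Lemma trace_surface_gradient (n : 'rV[R]_3 -> 'rV[R]_3) x : D x ->
  \tr (surface_gradient n W x) = vgrad x 0 2 - n x 0 2 * dot (n x) (vgrad x).
Proof.
move=> Dx; rewrite /surface_gradient mulmxBl mul1mx linearB /=; congr (_ - _).
  rewrite /mxtrace (bigD1 2)//= big1 ?addr0 => [|i i2].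
    by rewrite [RHS]mxE.
  by rewrite jacobian_vertical// (negbTE i2).
rewrite -mulmxA mxtrace_mulC /mxtrace big_ord1 mxE.
rewrite (bigD1 2)//= big1 ?addr0 => [|i i2].
  rewrite [X in _ * X]mxE mulrC /dot [in RHS]mxE mxE; congr (_ * _).
  by apply: eq_bigr => i _; rewrite [in RHS]mxE [X in _ = _ * X]mxE.
rewrite mxE; under eq_bigr do rewrite jacobian_vertical// (negbTE i2) mulr0.
by rewrite big1_eq mul0r.
Qed.

End vertical.

Lemma gramE (R : realType) (psi : R * R -> 'rV[R]_3) u : gram psi u =
  dot ('D_(1, 0) psi u) ('D_(1, 0) psi u) *
  dot ('D_(0, 1) psi u) ('D_(0, 1) psi u) -
  dot ('D_(1, 0) psi u) ('D_(0, 1) psi u) ^+ 2.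
Proof. by []. Qed.

Lemma near_eq_gram (R : realType) (psi psi' : R * R -> 'rV[R]_3) u :
  {near u, psi =1 psi'} -> gram psi u = gram psi' u.
Proof.
by move=> e; rewrite !gramE !(near_eq_derive _ e).
Qed.

(** The normalized cross product. It replaces the unit normal field when a chart is transported and
    no such field is given. *)
Lemma exists_unit_orthogonal (R : realType) (a b : 'rV[R]_3) :
  0 < dot a a * dot b b - dot a b ^+ 2 ->
  exists n, [/\ dot n n = 1, dot n a = 0 & dot n b = 0].
Proof.
set N : 'rV[R]_3 := \row_j [:: a 0 1 * b 0 2 - a 0 2 * b 0 1;
  a 0 2 * b 0 0 - a 0 0 * b 0 2; a 0 0 * b 0 1 - a 0 1 * b 0 0]`_j.
have -> : dot a a * dot b b - dot a b ^+ 2 = dot N N.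
  by rewrite !dotE !mxE /=; ring.
move=> N0; exists ((Num.sqrt (dot N N))^-1 *: N).
have dotZ k (u v : 'rV[R]_3) : dot (k *: u) v = k * dot u v.
  by rewrite !dotE !mxE; ring.
split.
- rewrite dotZ (_ : dot N (_ *: N) = (Num.sqrt (dot N N))^-1 * dot N N).
    by rewrite mulrA -invfM -expr2 sqr_sqrtr ?ltW// mulVf// gt_eqF.
  by rewrite !dotE !mxE; ring.
- by rewrite dotZ !dotE !mxE /=; ring.
- by rewrite dotZ !dotE !mxE /=; ring.
Qed.

Lemma dot_eq0 (R : realType) (u : 'rV[R]_3) : dot u u = 0 -> u = 0.
Proof.
rewrite dotE -!expr2 => /eqP; rewrite !paddr_eq0 ?addr_ge0 ?sqr_ge0//.
rewrite !sqrf_eq0 => /andP[/andP[/eqP u0 /eqP u1] /eqP u2].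
apply/rowP => -[[|[|[|//]]] jlt]; rewrite mxE.
- by rewrite -[RHS]u0; congr (u _ _); apply/val_inj.
- by rewrite -[RHS]u1; congr (u _ _); apply/val_inj.
- by rewrite -[RHS]u2; congr (u _ _); apply/val_inj.
Qed.

Lemma dot_ge0 (R : realType) (u : 'rV[R]_3) : 0 <= dot u u.
Proof. by rewrite dotE -!expr2 !addr_ge0// sqr_ge0. Qed.

(** The third component of the conormal m is n_3. If m = 0, then n_3 = 0, so m = (1 + t g_3) n,
    which is not 0. This makes transported charts regular. *)
Lemma conormal_gt0 (R : realType) (t : R) (n g : 'rV[R]_3) :
  dot n n = 1 -> 1 + t * g 0 2 != 0 ->
  0 < dot (conormal t n g) (conormal t n g).
Proof.
move=> nn tg; rewrite lt0r dot_ge0 andbT; apply/eqP => /dot_eq0 m0.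
have n2 : n 0 2 = 0.
  have /rowP/(_ 2) := m0; rewrite !mxE => /eqP.
  by rewrite (mulrC (g 0 2)) subrr mulr0 addr0 => /eqP.
have : (1 + t * g 0 2) *: n = 0.
  by rewrite -m0 /conormal n2 scale0r subr0 scalerA scalerDl scale1r.
move/eqP; rewrite scaler_eq0 (negbTE tg)/= => /eqP n0.
move: nn; rewrite n0 dotE !mxE !mulr0 !addr0 => /eqP.
by rewrite eq_sym oner_eq0.
Qed.

Lemma ale_map_C1_on (R : realType) (D : set 'rV[R]_3)
    (W : 'rV[R]_3 -> 'rV[R]_3) (t : R) :
  open D -> C1_on D W -> C1_on D (ale_map W t).
Proof.
move=> oD cW x Dx; have [dW cdW] := cW _ Dx.
have dA y : D y -> differentiable (ale_map W t) y.
  move=> /cW[dWy _]; apply: differentiableD => //.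
  exact: differentiableZ.
split=> [|v]; first exact: dA.
have E y : D y -> 'D_v (ale_map W t) y = v + t *: 'D_v W y.
  move=> /cW[dWy _]; rewrite (@deriveD _ _ _ idfun (t \*: W))//.
  - by rewrite derive_id deriveZ//; exact: diff_derivable.
  - apply: diff_derivable; exact: differentiableZ.
have nE : {near x, (fun y => v + t *: 'D_v W y) =1 'D_v (ale_map W t)}.
  by near=> y; apply/esym/E; near: y; exact: open_nbhs_nbhs.
rewrite /prop_for /continuous_at E//.
apply: cvg_trans (near_eq_cvg nE) _.
by apply: cvgD; [exact: cvg_cst|apply: cvgZl_tmp; exact: cdW].
Unshelve. all: by end_near. Qed.

Lemma derive_ale_map (R : realType) (D : set 'rV[R]_3)
    (W : 'rV[R]_3 -> 'rV[R]_3) (t : R) x v :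
  open D -> C1_on D W -> (forall x, D x -> W x 0 0 = 0 /\ W x 0 1 = 0) ->
  D x -> 'D_v (ale_map W t) x = shear t (vgrad W x) v.
Proof.
move=> oD cW Wv Dx.
rewrite (@deriveD _ _ _ idfun (t \*: W))//.
- rewrite derive_id deriveZ//; last first.
    by apply: diff_derivable; have [] := cW _ Dx.
  rewrite (derive_vertical oD _ Wv)//; last by move=> y /cW[].
  by rewrite scalerA.
- by apply: diff_derivable; apply: differentiableZ; have [] := cW _ Dx.
Qed.

Lemma derive_comp_point (R : realType) (V W : normedModType R)
    (f : V -> 'rV[R]_3) (g : 'rV[R]_3 -> W) (x v : V) :
  differentiable f x -> differentiable g (f x) ->
  'D_v (g \o f) x = 'D_('D_v f x) g (f x).
Proof.
move=> df dg; rewrite deriveE; last exact: differentiable_comp.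
by rewrite [RHS]deriveE// diff_comp//= deriveE.
Qed.

(** * Vertical motions *)

(* The inverse B is a parameter rather than [pinv D A], so that exchanging
   (A, t, W) with (B, - t, W \o B) yields another instance. *)
Record vertical_move (R : realType) (t : R) (D D' : set 'rV[R]_3)
    (A B W : 'rV[R]_3 -> 'rV[R]_3) : Prop := VerticalMove {
  vm_openl : open D;
  vm_openr : open D';
  vm_fun : forall x, D x -> D' (A x);
  vm_inv : forall y, D' y -> D (B y);
  vm_funK : forall x, D x -> B (A x) = x;
  vm_invK : forall y, D' y -> A (B y) = y;
  vm_funC1 : C1_on D A;
  vm_invC1 : C1_on D' B;
  vm_velC1 : C1_on D W;
  vm_vert : forall x, D x -> W x 0 0 = 0 /\ W x 0 1 = 0;
  vm_eq : forall x, D x -> A x = ale_map W t x }.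

Lemma vertical_move_sym (R : realType) (t : R) (D D' : set 'rV[R]_3)
    (A B W : 'rV[R]_3 -> 'rV[R]_3) :
  vertical_move t D D' A B W -> vertical_move (- t) D' D B A (W \o B).
Proof.
move=> [oD oD' fA fB BA AB cA cB cW Wv Ae].
have cWB : C1_on D' (W \o B) by exact: (C1_on_comp oD' fB).
apply: (VerticalMove oD' oD fB fA AB BA cB cA cWB) => y D'y.
  exact: Wv (fB _ D'y).
have := Ae _ (fB _ D'y).
by rewrite AB// /ale_map/= => {2}->; rewrite scaleNr addrK.
Qed.

Section vertical_move.
Context (R : realType) (t : R) (D D' : set 'rV[R]_3).
Context (A B W : 'rV[R]_3 -> 'rV[R]_3).
Hypothesis AW : vertical_move t D D' A B W.

Let oD := vm_openl AW.
Let cW := vm_velC1 AW.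

Lemma derive_move x v : D x -> 'D_v A x = shear t (vgrad W x) v.
Proof.
move=> Dx; rewrite -(derive_ale_map _ _ oD cW (vm_vert AW) Dx).
apply: near_eq_derive; near=> y; apply: (vm_eq AW); near: y.
exact: open_nbhs_nbhs.
Unshelve. all: by end_near. Qed.

Lemma derive_inv_move x v : D x -> 'D_(shear t (vgrad W x) v) B (A x) = v.
Proof.
move=> Dx; rewrite -derive_move// -derive_comp_point.
- rewrite -[RHS](derive_id x v); apply: near_eq_derive; near=> y.
  by apply: (vm_funK AW); near: y; exact: open_nbhs_nbhs.
- by have [] := vm_funC1 AW Dx.
- by have [] := vm_invC1 AW (vm_fun AW Dx).
Unshelve. all: by end_near. Qed.

(** The differential of [A] multiplies e_3 by this number; if it were 0, the differential of [B]
    would send 0 to e_3. *)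
Lemma vertical_jacobian_neq0 x : D x -> 1 + t * vgrad W x 0 2 != 0.
Proof.
move=> Dx; apply/eqP => t0.
have := derive_inv_move (delta_mx 0 2) Dx.
have -> : shear t (vgrad W x) (delta_mx 0 2) = 0.
  rewrite /shear (_ : dot _ _ = vgrad W x 0 2); last first.
    rewrite dotE [X in X * _]mxE [X in _ + X * _ + _]mxE [X in _ + X * _]mxE /=.
    by rewrite !mul0r mul1r !add0r.
  by rewrite -[X in X + _]scale1r -scalerDl t0 scale0r.
rewrite deriveE; last by have [] := vm_invC1 AW (vm_fun AW Dx).
rewrite linear0 => /rowP/(_ 2); rewrite !mxE/= => /eqP.
by rewrite eq_sym oner_eq0.
Qed.

Lemma derive_ale_comp (psi : R * R -> 'rV[R]_3) s u v : differentiable psi u ->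
  D (psi u) ->
  'D_v (ale_map W s \o psi) u = shear s (vgrad W (psi u)) ('D_v psi u).
Proof.
move=> dpsi Du; rewrite derive_comp_point//.
  by rewrite (derive_ale_map _ _ oD cW (vm_vert AW)).
by have [] := ale_map_C1_on s oD cW Du.
Qed.

(** The step [s] is independent of [t]: the polarization in [measurable_trace] takes s = 1 and s = -
    1, for which [ale_map W s] need not be injective. *)
Lemma gram_ale_comp (psi : R * R -> 'rV[R]_3) s u n : differentiable psi u ->
  D (psi u) -> dot n n = 1 -> dot n ('D_(1, 0) psi u) = 0 ->
  dot n ('D_(0, 1) psi u) = 0 ->
  gram (ale_map W s \o psi) u =
  gram psi u * dot (conormal s n (vgrad W (psi u)))
                   (conormal s n (vgrad W (psi u))).
Proof.
move=> dpsi Du nn n1 n2.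
by rewrite !gramE !derive_ale_comp// (gram_shear _ _ nn).
Qed.

Lemma gram_move (U : set (R * R)) (psi : R * R -> 'rV[R]_3) u :
  open U -> C1_on U psi -> U u -> D (psi u) ->
  gram (A \o psi) u = gram (ale_map W t \o psi) u.
Proof.
move=> oU cpsi Uu Du; apply: near_eq_gram.
have cu : {for u, continuous psi} by exact: C1_on_continuous cpsi Uu.
have nD : nbhs (psi u) D by exact: open_nbhs_nbhs.
by near=> v; apply: (vm_eq AW); near: v; exact: cu.
Unshelve. all: by end_near. Qed.

Context (S : set 'rV[R]_3) (SD : S `<=` D).

(** On the part of [U] outside the half-plane [H], [psi] may leave [D], so [U] has to shrink. On [H]
    it takes its values in [S], hence in [D]: the parameter region, and so the domain of
    integration, is the same for both charts. *)
Lemma is_chart_move (H U : set (R * R)) (V : set 'rV[R]_3)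
    (psi : R * R -> 'rV[R]_3) : is_chart S H U V psi ->
  U `&` psi @^-1` D `&` H = U `&` H /\
  is_chart (A @` S) H (U `&` psi @^-1` D) (D' `&` B @^-1` V) (A \o psi).
Proof.
move=> [mH [oU oV] [cpsi gpsi] [ipsi im] cinv].
have UHD : U `&` H `<=` psi @^-1` D.
  move=> u UHu; apply: SD.
  by have [] : (S `&` V) (psi u) by rewrite -im; exists u.
have UH : U `&` psi @^-1` D `&` H = U `&` H.
  by rewrite setIAC; apply: setIidl.
have oU' : open (U `&` psi @^-1` D) by exact: C1_on_open_preimage.
have oB := C1_on_open_preimage (vm_openr AW) (vm_invC1 AW).
have oV' : open (D' `&` B @^-1` V) by exact: oB.
have imA : (A \o psi) @` (U `&` H) = A @` S `&` (D' `&` B @^-1` V).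
  rewrite -image_comp im; apply/seteqP; split=> [_ [x [Sx Vx] <-]|].
    split; first by exists x.
    split; first exact: (vm_fun AW) (SD Sx).
    by rewrite /preimage/= (vm_funK AW)//; exact: SD.
  move=> _ [[x Sx <-] [_ Vx]]; exists x => //; split => //.
  by move: Vx; rewrite /preimage/= (vm_funK AW)//; exact: SD.
have iA : {in U `&` H &, injective (A \o psi)}.
  move=> u v /[!inE] Uu Uv /= /(congr1 B); rewrite !(vm_funK AW); last 2 first.
  - exact: UHD.
  - exact: UHD.
  by apply: ipsi; rewrite inE.
split => //; split=> //; rewrite ?UH//.
- split.
    apply: (C1_on_comp oU' (D := D)); [by move=> u []| |exact: vm_funC1 AW].
    by apply: C1_on_subset cpsi => u [].
  move=> u [Uu Du]; rewrite (gram_move oU cpsi)//.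
  have [n [nn n1 n2]] := exists_unit_orthogonal (gpsi _ Uu).
  rewrite (gram_ale_comp _ _ _ nn)//; last by have [] := cpsi _ Uu.
  rewrite mulr_gt0 ?gpsi// conormal_gt0//.
  exact: vertical_jacobian_neq0.
(* The inverse of the new chart is the inverse of [psi] after [B], so the open set [V0] obtained for
   [psi] is pulled back by [B]. *)
- apply/continuousP => G oG; apply/open_subspaceP.
  have [V0 oV0 V0E] := within_continuous_preimage cinv oG.
  exists (D' `&` B @^-1` V0); first exact: oB.
  have key u : (U `&` H) u ->
      (pinv (U `&` H) (A \o psi) (A (psi u)) = u) *
      (pinv (U `&` H) psi (psi u) = u).
    move=> Uu; split.
      by rewrite -[A (psi u)]/((A \o psi) u) pinvKV ?inE.
    by rewrite pinvKV ?inE.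
  rewrite -imA; apply/seteqP; split => [_ [/[swap] [[u Uu <-]] [_ h]]|
                                        _ [/[swap] [[u Uu <-]] h]].
    split; last by exists u.
    move: h; rewrite /preimage/= (vm_funK AW); last exact: UHD.
    move=> h; have : (S `&` V `&` V0) (psi u).
      by split => //; rewrite -im; exists u.
    rewrite -V0E => -[_]; rewrite /from_subspace /preimage/= (key u Uu).2.
    by rewrite /from_subspace /preimage/= (key u Uu).1.
  have Du := UHD _ Uu.
  split; last by exists u.
  split; first exact: (vm_fun AW).
  rewrite /preimage/= (vm_funK AW)//.
  suff : (S `&` V `&` V0) (psi u) by case.
  rewrite -V0E; split; first by rewrite -im; exists u.
  by move: h; rewrite /from_subspace /preimage/= (key u Uu).1 (key u Uu).2.
Qed.

End vertical_move.

(** * Change of variables on a hypersurface *)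

Lemma within_continuous_in (T S : topologicalType) (A : set T) (f : T -> S) :
  (forall x, A x -> {for x, continuous f}) -> {within A, continuous f}.
Proof.
move=> cf; apply/subspace_continuousP => x Ax.
exact: cvg_within_filter (cf x Ax).
Qed.

Lemma continuous_dot (R : realType) (T : topologicalType) (f g : T -> 'rV[R]_3)
    (x : T) : (forall j, {for x, continuous (fun y => f y 0 j)}) ->
  (forall j, {for x, continuous (fun y => g y 0 j)}) ->
  {for x, continuous (fun y => dot (f y) (g y))}.
Proof.
move=> cf cg; rewrite /prop_for /continuous_at dotE.
under eq_fun do rewrite dotE.
by do 2 ?apply: cvgD; apply: cvgM; by [exact: cf|exact: cg].
Qed.

Lemma continuous_gram (R : realType) (U : set (R * R)) (psi : R * R -> 'rV[R]_3)
    u : C1_on U psi -> U u -> {for u, continuous (gram psi)}.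
Proof.
move=> cpsi Uu; have [_ cd] := cpsi _ Uu.
have cdot v w :
    {for u, continuous (fun y => dot ('D_v psi y) ('D_w psi y))}.
  apply: (@continuous_dot _ _ ('D_v psi) ('D_w psi)) => j;
    apply: (cvg_comp _ (fun M : 'rV[R]_3 => M 0 j) (cd _));
    exact: coord_continuous.
apply: cvgB; first by apply: cvgM; exact: cdot.
by rewrite expr2; under eq_fun do rewrite expr2; apply: cvgM; exact: cdot.
Qed.

Lemma measurable_gram (R : realType) (U : set (R * R))
    (psi : R * R -> 'rV[R]_3) (P : set (R * R)) :
  open U -> C1_on U psi -> P `<=` U -> measurable (P : set (plane R)) ->
  measurable_fun (P : set (plane R)) (gram psi : plane R -> R).
Proof.
move=> oU cpsi PU mP; apply: measurable_fun_open => G oG.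
apply: measurable_plane_preimage => //.
apply: within_continuous_in => u /PU Uu; exact: continuous_gram cpsi Uu.
Qed.

Section chart.
Context (R : realType) (S : set 'rV[R]_3) (H U : set (R * R)).
Context (V : set 'rV[R]_3) (psi : R * R -> 'rV[R]_3).
Hypothesis (psiP : is_chart S H U V psi).
Hypothesis (mS : measurable (S : set (borel3 R))).

Lemma chart_domain_measurable : measurable (U `&` H : set (plane R)).
Proof.
have [mH [oU _] _ _ _] := psiP.
apply: measurableI; first exact: open_measurable_plane.
exact: model_region_measurable.
Qed.

Lemma chart_codomain_measurable : measurable (S `&` V : set (borel3 R)).
Proof.
have [_ [_ oV] _ _ _] := psiP.
by apply: measurableI => //; exact: open_measurable_borel3.
Qed.

Lemma measurable_chart :
  measurable_fun (U `&` H : set (plane R)) (psi : plane R -> borel3 R).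
Proof.
have [_ [oU _] [cpsi _] _ _] := psiP.
apply: measurable_fun_borel3 => G oG.
apply: measurable_plane_preimage => //; first exact: chart_domain_measurable.
apply: within_continuous_in => u [Uu _]; exact: C1_on_continuous cpsi Uu.
Qed.

Lemma measurable_chart_inv : measurable_fun (S `&` V : set (borel3 R))
  (pinv (U `&` H) psi : borel3 R -> plane R).
Proof.
have [_ _ _ _ cinv] := psiP.
have mSV := chart_codomain_measurable.
have m1 : measurable_fun (S `&` V : set (borel3 R))
    ((fun x => (pinv (U `&` H) psi x).1) : borel3 R -> measurableTypeR R).
  apply: measurable_fun_open => G oG.
  apply: measurable_borel3_preimage => //.
  by move=> x; apply: continuous_comp; [exact: cinv|exact: cvg_fst].
have m2 : measurable_fun (S `&` V : set (borel3 R))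
    ((fun x => (pinv (U `&` H) psi x).2) : borel3 R -> measurableTypeR R).
  apply: measurable_fun_open => G oG.
  apply: measurable_borel3_preimage => //.
  by move=> x; apply: continuous_comp; [exact: cinv|exact: cvg_snd].
apply: (measurability _ (measurable_prod_measurableType _ _)).
move=> _ [_ [X mX [Y mY <-]] <-].
rewrite (_ : S `&` V `&` _ @^-1` _ = (S `&` V `&`
    (fun x => (pinv (U `&` H) psi x).1) @^-1` X) `&` (S `&` V `&`
    (fun x => (pinv (U `&` H) psi x).2) @^-1` Y)).
  exact: measurableI (m1 mSV _ mX) (m2 mSV _ mY).
by apply/seteqP; split=> [x [SVx []]|x [[SVx ?] [_ ?]]].
Qed.

Lemma measurable_fun_chart (F : 'rV[R]_3 -> R) :
  measurable_fun (U `&` H : set (plane R)) (F \o psi : plane R -> R) ->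
  measurable_fun (S `&` V : set (borel3 R)) (F : borel3 R -> R).
Proof.
move=> mF; have [_ _ _ [ipsi im] _] := psiP.
have psiK x : (S `&` V) x ->
    (U `&` H) (pinv (U `&` H) psi x) /\ psi (pinv (U `&` H) psi x) = x.
  by rewrite -im => -[u Uu <-]; rewrite pinvKV ?inE.
apply: (@eq_measurable_fun _ _ _ _ _
    ((F \o psi) \o (pinv (U `&` H) psi) : borel3 R -> R)).
  by move=> x /[!inE] /psiK[_] /= ->.
apply: (measurable_comp chart_domain_measurable) => //.
  by move=> _ [x /psiK[h _] <-].
exact: measurable_chart_inv.
Qed.

Lemma ge0_integral_chart (sigma : {measure set (borel3 R) -> \bar R})
    (C : set 'rV[R]_3) (f : 'rV[R]_3 -> \bar R) :
  surface_measure S sigma -> measurable (C : set (borel3 R)) ->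
  C `<=` S `&` V ->
  measurable_fun (C : set (borel3 R)) (f : borel3 R -> \bar R) ->
  (forall x, C x -> 0 <= f x)%E ->
  (\int[sigma]_(x in (C : set (borel3 R))) f x =
   \int[lebesgue_measure \x lebesgue_measure]_(u in U `&` H `&` psi @^-1` C)
     (f (psi u) * (Num.sqrt (gram psi u))%:E))%E.
Proof.
move=> [_ sigmaE] mC CSV mf f0; have [_ [oU _] [cpsi gpsi] _ _] := psiP.
have mP : measurable (U `&` H `&` psi @^-1` C : set (plane R)).
  by apply: measurable_chart => //; exact: chart_domain_measurable.
apply: (@ge0_integral_density _ _ (plane R) (borel3 R)) => //.
- apply: measurable_funS measurable_chart; first exact: chart_domain_measurable.
  by move=> u [].
- apply: (measurableT_comp (f := @Num.sqrt R)).
    by have := continuous_measurable_fun (@sqrt_continuous R).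
  by apply: measurable_gram oU cpsi _ mP => u [[]].
- move=> B mB BC; have := sigmaE _ _ _ _ psiP B mB.
  rewrite (_ : B `&` V = B); last by apply: setIidl => x /BC/CSV[].
  move=> ->; congr integral.
  apply/seteqP; split=> [u [UHu Bu]|u [[UHu _] Bu]//].
  by split => //; split => //; exact: BC.
Qed.

End chart.

(** Compactness gives a finite atlas; it is listed as a sequence with repetitions, the form suited
    to countable additivity. An empty [S] has no point to repeat and receives empty charts. *)
Lemma countable_atlas (R : realType) (S : set 'rV[R]_3) :
  compact S -> smooth_hypersurface S ->
  exists (H U : nat -> set (R * R)) (V : nat -> set 'rV[R]_3)
         (psi : nat -> R * R -> 'rV[R]_3),
    (forall k, is_chart S (H k) (U k) (V k) (psi k)) /\ S `<=` \bigcup_k V k.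
Proof.
move=> cS sS.
pose data := (set (R * R) * set (R * R) * set 'rV[R]_3 *
  (R * R -> 'rV[R]_3))%type.
pose chart (c : data) := is_chart S c.1.1.1 c.1.1.2 c.1.2 c.2.
have [S0|/set0P[p0 Sp0]] := eqVneq S set0.
  exists (fun=> setT), (fun=> set0), (fun=> set0), (fun=> fun=> 0).
  rewrite S0; split=> [_|//]; split => //.
  - by left.
  - by split; exact: open0.
  - by rewrite !set0I image_set0; split=> // u v; rewrite in_set0.
  - by rewrite set0I; exact: continuous_subspace0.
have /choice[c cP] : forall p, exists c : data, S p -> chart c /\ c.1.2 p.
  move=> p; have [/sS[H [U [V [psi [h Vp]]]]]|nSp] := pselect (S p).
    by exists (H, U, V, psi).
  by exists (setT, setT, setT, fun=> 0) => /nSp.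
have := cS; rewrite compact_cover => /(_ _ S (fun p => (c p).1.2))[].
- by move=> p Sp; have [[_ [_ oV] _ _ _] _] := cP _ Sp.
- by move=> p Sp; exists p => //; have [] := cP _ Sp.
move=> F FS Scov.
(* Past the end of the list the value is [p0], a point of [S], so every index yields a genuine
   chart. *)
pose p k := nth p0 (finmap.enum_fset F) k.
have Sp k : S (p k).
  rewrite /p; have [kF|kF] := ltnP k (size (finmap.enum_fset F)).
    by apply/set_mem/FS/mem_nth.
  by rewrite nth_default.
exists (fun k => (c (p k)).1.1.1), (fun k => (c (p k)).1.1.2),
  (fun k => (c (p k)).1.2), (fun k => (c (p k)).2); split.
  by move=> k; have [] := cP _ (Sp k).
move=> x /Scov[q /= qF Vx]; exists (index q (finmap.enum_fset F)) => //.
by rewrite /p nth_index.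
Qed.

Section surface.
Context (R : realType) (t : R) (D D' : set 'rV[R]_3).
Context (A B W : 'rV[R]_3 -> 'rV[R]_3).
Hypothesis AW : vertical_move t D D' A B W.
Context (S : set 'rV[R]_3) (n : 'rV[R]_3 -> 'rV[R]_3).
Hypotheses (SD : S `<=` D) (cS : compact S) (sS : smooth_hypersurface S).
Hypothesis nS : unit_normal S n.

Lemma compact_borel3 (C : set 'rV[R]_3) : compact C ->
  measurable (C : set (borel3 R)).
Proof.
move=> cC; rewrite -[C]setCK; apply: measurableC.
apply: open_measurable_borel3; apply: closed_openC.
by apply: compact_closed => //; exact: norm_hausdorff.
Qed.

Lemma move_image_compact : compact (A @` S).
Proof.
apply: continuous_compact cS; apply: within_continuous_in => x /SD Dx.
exact: C1_on_continuous (vm_funC1 AW) Dx.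
Qed.

Lemma move_image_measurable (C : set 'rV[R]_3) : C `<=` S ->
  measurable (C : set (borel3 R)) -> measurable (A @` C : set (borel3 R)).
Proof.
move=> CS mC.
have mS' := compact_borel3 move_image_compact.
have mB : measurable_fun (A @` S : set (borel3 R)) (B : borel3 R -> borel3 R).
  apply: measurable_fun_borel3 => G oG; apply: measurable_borel3_preimage => //.
  apply: within_continuous_in => _ [x /SD Dx <-].
  exact: C1_on_continuous (vm_invC1 AW) (vm_fun AW Dx).
have -> : A @` C = A @` S `&` B @^-1` C; last exact: mB.
apply/seteqP; split=> [_ [x Cx <-]|_ [[x Sx <-]]].
  split; first by exists x => //; exact: CS.
  by rewrite /preimage/= (vm_funK AW)//; exact/SD/CS.
rewrite /preimage/= (vm_funK AW); last exact: SD.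
by exists x.
Qed.

(** The square of the ratio of the area elements under [ale_map W s]. *)
Definition conormal2 s x :=
  dot (conormal s (n x) (vgrad W x)) (conormal s (n x) (vgrad W x)).

Lemma gram_ale_normal H U V psi s u : is_chart S H U V psi -> (U `&` H) u ->
  gram (ale_map W s \o psi) u = gram psi u * conormal2 s (psi u).
Proof.
move=> psiP UHu; have [_ [oU _] [cpsi _] [_ im] _] := psiP.
have Su : S (psi u) by have [] : (S `&` V) (psi u) by rewrite -im; exists u.
have [n1 n2] := nS.2 _ _ _ _ psiP _ UHu.
apply: (gram_ale_comp AW s _ _ (nS.1 _ Su)) => //; last exact: SD.
by have [] := cpsi _ UHu.1.
Qed.

(* n need not be measurable, but [conormal2] is even in n: in a chart it is a
   quotient of Gram determinants. *)
Lemma measurable_conormal2 s :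
  measurable_fun (S : set (borel3 R)) (conormal2 s : borel3 R -> R).
Proof.
have mS := compact_borel3 cS.
have [H [U [V [psi [psiP SV]]]]] := countable_atlas cS sS.
have -> : S = \bigcup_k (S `&` V k).
  by rewrite -setI_bigcupr; symmetry; exact: setIidl.
apply/measurable_fun_bigcup => k.
  exact: (chart_codomain_measurable (psiP k)).
apply: (measurable_fun_chart (psiP k)) => //.
have mUH := chart_domain_measurable (psiP k).
have [_ [oU _] [cpsi gpsi] [_ im] _] := psiP k.
have oU' : open (U k `&` psi k @^-1` D).
  exact: C1_on_open_preimage oU cpsi (vm_openl AW).
have UHD : U k `&` H k `<=` U k `&` psi k @^-1` D.
  move=> u [Uu Hu]; split => //; apply: SD.
  by have [] : (S `&` V k) (psi k u) by rewrite -im; exists u.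
have m1 := measurable_gram oU cpsi (fun u h => (UHD u h).1) mUH.
have cA := ale_map_C1_on s (vm_openl AW) (vm_velC1 AW).
have m2 : measurable_fun (U k `&` H k : set (plane R))
    (gram (ale_map W s \o psi k) : plane R -> R).
  apply: (measurable_gram oU' _ UHD) => //.
  apply: (C1_on_comp oU' (D := D)) => // [u []//|].
  by apply: C1_on_subset cpsi => u [].
apply: (@eq_measurable_fun _ _ (plane R) _ _
  (fun u => gram (ale_map W s \o psi k) u * (gram (psi k) u)^-1)).
  move=> u /[!inE] UHu /=; rewrite (gram_ale_normal _ (psiP k))// mulrAC.
  by rewrite divff ?mul1r// gt_eqF// gpsi//; have [] := UHu.
apply: measurable_funM => //.
apply: measurable_fun_open => G oG; apply: measurable_plane_preimage => //.
apply: within_continuous_in => u [Uu _].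
apply: cvgV; first by rewrite gt_eqF// gpsi.
exact: continuous_gram cpsi Uu.
Qed.

Context (sigma sigma' : {measure set (borel3 R) -> \bar R}).
Hypotheses (sigmaP : surface_measure S sigma)
  (sigmaP' : surface_measure (A @` S) sigma').

Definition area_ratio x := Num.sqrt (conormal2 t x).

Lemma measurable_area_ratio :
  measurable_fun (S : set (borel3 R)) (area_ratio : borel3 R -> R).
Proof.
apply: (measurableT_comp (f := @Num.sqrt R)) (measurable_conormal2 t).
by have := continuous_measurable_fun (@sqrt_continuous R).
Qed.

(** A countable atlas is cut into disjoint pieces [C k]. On each piece both integrals are computed
    over the same region of the plane, with [psi] and [A \o psi], and the area elements differ by
    the factor [area_ratio]. *)
Lemma ge0_change_of_variables (g : 'rV[R]_3 -> \bar R) :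
  measurable_fun (A @` S : set (borel3 R)) (g : borel3 R -> \bar R) ->
  (forall y, (A @` S) y -> 0 <= g y)%E ->
  (\int[sigma']_(y in (A @` S : set (borel3 R))) g y =
   \int[sigma]_(x in (S : set (borel3 R))) (g (A x) * (area_ratio x)%:E))%E.
Proof.
move=> mg g0.
have mS := compact_borel3 cS.
have mS' := compact_borel3 move_image_compact.
have [H [U [V [psi [psiP SV]]]]] := countable_atlas cS sS.
pose C k := seqDU (fun k => S `&` V k) k.
have mSV k : measurable (S `&` V k : set (borel3 R)).
  exact: (chart_codomain_measurable (psiP k)).
have mC k : measurable (C k : set (borel3 R)) by exact: seqDU_measurable.
have CSV k : C k `<=` S `&` V k by exact: subset_seqDU.
have CS k : C k `<=` S by move=> x /CSV[].
have SE : S = \bigcup_k C k.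
  by rewrite -seqDU_bigcup_eq -setI_bigcupr; symmetry; exact: setIidl.
have S'E : A @` S = \bigcup_k (A @` C k) by rewrite {1}SE image_bigcup.
have mA : measurable_fun (S : set (borel3 R)) (A : borel3 R -> borel3 R).
  apply: measurable_fun_borel3 => G oG; apply: measurable_borel3_preimage => //.
  apply: within_continuous_in => x /SD Dx.
  exact: C1_on_continuous (vm_funC1 AW) Dx.
have mgA : measurable_fun (S : set (borel3 R)) (g \o A : borel3 R -> \bar R).
  by apply: (measurable_comp mS') => //; exact: mg.
have mgAJ : measurable_fun (S : set (borel3 R))
    ((fun x => g (A x) * (area_ratio x)%:E)%E : borel3 R -> \bar R).
  apply: emeasurable_funM; first exact: mgA.
  by apply/measurable_EFinP; exact: measurable_area_ratio.
have gAJ0 x : S x -> (0 <= g (A x) * (area_ratio x)%:E)%E.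
  by move=> Sx; rewrite mule_ge0 ?lee_fin ?sqrtr_ge0//; apply: g0; exists x.
have tC : trivIset setT (fun k => A @` C k).
  apply/trivIsetP => i j _ _ ij.
  have /trivIsetP/(_ i j I I ij) CC := trivIset_seqDU (fun k => S `&` V k).
  apply/seteqP; split=> // _ [[x Cx <-] [y Cy /(congr1 B)]].
  rewrite !(vm_funK AW); last 2 first.
  - exact: SD (CS _ _ Cx).
  - exact: SD (CS _ _ Cy).
  move=> yx; suff : set0 x by [].
  by rewrite -CC; split; [exact: Cx|rewrite -yx; exact: Cy].
rewrite {1}S'E ge0_integral_bigcup; last 4 first.
- by move=> k; exact: move_image_measurable.
- by rewrite -S'E.
- by rewrite -S'E.
- exact: tC.
rewrite [in RHS]SE ge0_integral_bigcup; last 4 first.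
- exact: mC.
- by rewrite -SE.
- by rewrite -SE.
- exact: trivIset_seqDU.
apply: eq_eseriesr => k _.
have [UHE psiP'] := is_chart_move AW SD (psiP k).
have CV' : A @` C k `<=` A @` S `&` (D' `&` B @^-1` V k).
  move=> _ [x /CSV[Sx Vx] <-]; split; first by exists x.
  split; first exact/(vm_fun AW)/SD.
  by rewrite /preimage/= (vm_funK AW)//; exact: SD.
have mAC := move_image_measurable (CS k) (mC k).
rewrite (ge0_integral_chart psiP' sigmaP' mAC CV').
- rewrite (ge0_integral_chart (psiP k) sigmaP (mC k) (CSV k)).
  + rewrite UHE.
    have [_ [oU _] [cpsi _] [_ im] _] := psiP k.
    have Su u : (U k `&` H k) u -> S (psi k u).
      by move=> UHu; have [] : (S `&` V k) (psi k u) by rewrite -im; exists u.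
    rewrite (_ : U k `&` H k `&` (A \o psi k) @^-1` (A @` C k) =
                 U k `&` H k `&` psi k @^-1` C k); last first.
      apply/seteqP; split=> u [UHu]; rewrite /preimage/=.
        move=> [x Cx /(congr1 B)]; rewrite !(vm_funK AW) => [xu| |].
        * by split => //=; rewrite -xu.
        * exact/SD/Su.
        * exact/SD/(CS _ _ Cx).
      by move=> Cu; split => //; exists (psi k u).
    apply: eq_integral => u /[!inE] -[UHu Cu].
    rewrite -muleA; congr (_ * _)%E; rewrite -EFinM; congr EFin.
    rewrite (gram_move AW oU cpsi UHu.1); last exact/SD/Su.
    rewrite (gram_ale_normal _ (psiP k))// sqrtrM 1?mulrC//.
    have [_ _ [_ gpsi] _ _] := psiP k.
    by apply: ltW; apply: gpsi; have [] := UHu.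
  + exact: (measurable_funS mS (CS k) mgAJ).
  + by move=> x /CS; exact: gAJ0.
- apply: measurable_funS mS' _ mg; exact: image_subset.
- by move=> _ [x /CS Sx <-]; apply: g0; exists x.
Qed.

End surface.

(** * First-order estimates *)

(** The quantitative form of [conormal_gt0], meant for steps so large that 1 + t T gives no positive
    lower bound. It follows from (1 + t g_3) n = m + t n_3 g and n_3^2 <= |m|^2. *)
Lemma conormal_lower_bound (R : realType) (t G c : R) (n g : 'rV[R]_3) :
  dot n n = 1 -> dot g g <= G ^+ 2 -> c ^+ 2 <= (1 + t * g 0 2) ^+ 2 ->
  c ^+ 2 <= (2 + 2 * t ^+ 2 * G ^+ 2) * dot (conormal t n g) (conormal t n g).
Proof.
move=> nn gG /le_trans; apply.
set m := conormal t n g.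
have m2 : n 0 2 ^+ 2 <= dot m m.
  rewrite dotE -!expr2 (_ : m 0 2 = n 0 2).
    by rewrite lerDr addr_ge0// sqr_ge0.
  by rewrite /m !mxE; ring.
have : (1 + t * g 0 2) ^+ 2 <=
    2 * dot m m + 2 * (t ^+ 2 * n 0 2 ^+ 2 * dot g g).
  have -> : (1 + t * g 0 2) ^+ 2 =
      dot (m + (t * n 0 2) *: g) (m + (t * n 0 2) *: g).
    have -> : m + (t * n 0 2) *: g = (1 + t * g 0 2) *: n.
      by apply/rowP => j; rewrite /m !mxE; ring.
    transitivity ((1 + t * g 0 2) ^+ 2 * dot n n); first by rewrite nn mulr1.
    by rewrite !dotE !mxE; ring.
  (* This is |u + v|^2 <= 2 |u|^2 + 2 |v|^2, from |u - v|^2 >= 0. *)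
  have := dot_ge0 (m - (t * n 0 2) *: g); rewrite !dotE !mxE.
  lra.
move/le_trans; apply.
have : t ^+ 2 * (n 0 2 ^+ 2 * dot g g) <= t ^+ 2 * (dot m m * G ^+ 2).
  by rewrite ler_wpM2l ?sqr_ge0// ler_pM ?sqr_ge0 ?dot_ge0.
lra.
Qed.

Section surface_integral.
Context (R : realType) (t : R) (D D' : set 'rV[R]_3).
Context (A B W : 'rV[R]_3 -> 'rV[R]_3).
Hypothesis AW : vertical_move t D D' A B W.
Context (S : set 'rV[R]_3) (n : 'rV[R]_3 -> 'rV[R]_3).
Hypotheses (SD : S `<=` D) (cS : compact S) (sS : smooth_hypersurface S).
Hypothesis nS : unit_normal S n.
Context (sigma sigma' : {measure set (borel3 R) -> \bar R}).
Hypotheses (sigmaP : surface_measure S sigma)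
  (sigmaP' : surface_measure (A @` S) sigma').
Context (G : R).
Hypotheses (G0 : 0 <= G)
  (gG : forall x, S x -> dot (vgrad W x) (vgrad W x) <= G ^+ 2).
Context (phi : 'rV[R]_3 -> R).

Let J := area_ratio t W n.
Let T x := \tr (surface_gradient n W x).

Let mS : measurable (S : set (borel3 R)). Proof. exact: compact_borel3. Qed.

Let TE x : S x -> T x = vgrad W x 0 2 - n x 0 2 * dot (n x) (vgrad W x).
Proof.
move=> /SD Dx; apply: (trace_surface_gradient (vm_openl AW)) => //.
- by move=> y /(vm_velC1 AW)[].
- exact: vm_vert AW.
Qed.

Let J_bounds x : S x -> [/\ `|T x| <= 2 * G, 1 + t * T x <= J x &
  2^-1 <= 1 + t * T x -> `|J x - (1 + t * T x)| <= t ^+ 2 * (4 * G ^+ 2)].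
Proof.
move=> Sx; rewrite TE//.
have [h1 h2 h3] := conormal_bound t (nS.1 _ Sx) (gG Sx) G0.
split => //; last by move=> h; exact: sqrt_estimate.
rewrite (le_trans (ler_norm _))// -sqrtr_sqr ler_sqrt//.
exact: dot_ge0.
Qed.

(* The trace is recovered from [conormal2] by polarization in t. *)
Lemma measurable_trace :
  measurable_fun (S : set (borel3 R)) (T : borel3 R -> R).
Proof.
have mc s := measurable_conormal2 AW SD cS sS nS s.
apply: (@eq_measurable_fun _ _ (borel3 R) _ _
    (fun x => 4^-1 * (conormal2 W n 1 x - conormal2 W n (- 1) x))).
  move=> x /[!inE] Sx; rewrite TE// /conormal2 /conormal; have := nS.1 _ Sx.
  move: (vgrad W x) (n x) => g m; rewrite !dotE !mxE => nn.
  transitivity ((m 0 0 * m 0 0 + m 0 1 * m 0 1 + m 0 2 * m 0 2) * g 0 2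
    - m 0 2 * (m 0 0 * g 0 0 + m 0 1 * g 0 1 + m 0 2 * g 0 2)).
    by field.
  by rewrite nn mul1r.
by apply: measurable_funM => //; exact: measurable_funB.
Qed.

Hypothesis iphi : sigma'.-integrable (A @` S : set (borel3 R)) (EFin \o phi).

Let mphi : measurable_fun (A @` S : set (borel3 R)) (phi : borel3 R -> R).
Proof. by apply/measurable_EFinP; exact: (measurable_int sigma' iphi). Qed.

Let mphiA : measurable_fun (S : set (borel3 R)) (phi \o A : borel3 R -> R).
Proof.
have mA : measurable_fun (S : set (borel3 R)) (A : borel3 R -> borel3 R).
  apply: measurable_fun_borel3 => O oO; apply: measurable_borel3_preimage => //.
  apply: within_continuous_in => x /SD Dx.
  exact: C1_on_continuous (vm_funC1 AW) Dx.
apply: (measurable_comp (compact_borel3 (move_image_compact AW SD cS))) => //.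
Qed.

Let mJ : measurable_fun (S : set (borel3 R)) (J : borel3 R -> R).
Proof. exact: (measurable_area_ratio AW SD cS sS nS). Qed.

Let cov := ge0_change_of_variables AW SD cS sS nS sigmaP sigmaP'.

Lemma cov_abs : (\int[sigma']_(y in (A @` S : set (borel3 R))) `|phi y|%:E =
  \int[sigma]_(x in (S : set (borel3 R))) (`|phi (A x)| * J x)%:E)%E.
Proof.
by rewrite cov//; apply/measurable_EFinP; exact: measurableT_comp.
Qed.

Lemma integrable_cov : sigma.-integrable (S : set (borel3 R))
  (fun x => (phi (A x) * J x)%:E).
Proof.
apply/integrableP; split.
  by apply/measurable_EFinP; apply: measurable_funM mJ; exact: mphiA.
have /integrableP[_] := iphi; under eq_integral do rewrite /= -/(_ `|_|).
apply: le_lt_trans; rewrite cov_abs le_eqVlt; apply/orP; left; apply/eqP.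
by apply: eq_integral => x _; rewrite /= normrM (ger0_norm (sqrtr_ge0 _)).
Qed.

Lemma Rintegral_cov :
  \int[sigma']_(y in (A @` S : set (borel3 R))) phi y =
  \int[sigma]_(x in (S : set (borel3 R))) (phi (A x) * J x).
Proof.
rewrite /Rintegral; congr fine.
have J0 x : 0 <= J x by exact: sqrtr_ge0.
(* The change of variables is for nonnegative functions; as J >= 0, it commutes with positive and
   negative parts. *)
rewrite integralE [RHS]integralE; congr (_ - _)%E.
- rewrite cov//.
  + apply: eq_integral => x _; rewrite -[in LHS]/(_ * _)%E !funeposE.
    by rewrite -!EFin_max -EFinM /= maxr_pMl// mul0r.
  + by apply/measurable_funepos/measurable_EFinP.
- rewrite cov//.
  + apply: eq_integral => x _; rewrite !funenegE.
    by rewrite -!EFinN -!EFin_max -EFinM /= maxr_pMl// mul0r mulNr.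
  + by apply/measurable_funeneg/measurable_EFinP.
Qed.

(** Domination by c^-1 |phi o A| J. It serves twice: with a tiny [c] for integrability at a fixed
    step, and with c = 1/2 to express the error through the L^1 norm on the new surface. *)
Lemma integrable_pullback (c : R) : 0 < c -> (forall x, S x -> c <= J x) ->
  sigma.-integrable (S : set (borel3 R)) (EFin \o (phi \o A)) /\
  c * \int[sigma]_(x in (S : set (borel3 R))) `|phi (A x)| <=
  \int[sigma']_(y in (A @` S : set (borel3 R))) `|phi y|.
Proof.
move=> c0 cJ.
have iA : sigma.-integrable (S : set (borel3 R)) (EFin \o (phi \o A)).
  have iJ := integrableZl mS c^-1 integrable_cov.
  apply: le_integrable iJ => //; first by apply/measurable_EFinP.
  move=> x Sx; rewrite /= lee_fin normrM normrM (ger0_norm (sqrtr_ge0 _)).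
  rewrite gtr0_norm ?invr_gt0// mulrC -mulrA ler_peMr//.
  by rewrite ler_pdivlMr// mul1r cJ.
split => //.
have -> : \int[sigma']_(y in (A @` S : set (borel3 R))) `|phi y| =
    \int[sigma]_(x in (S : set (borel3 R))) (`|phi (A x)| * J x).
  by rewrite /Rintegral cov_abs.
rewrite -RintegralZl//; last exact: (integrable_norm iA).
apply: le_Rintegral => //.
- by apply: (integrableZl mS c (integrable_norm iA)).
- apply: eq_integrable (integrable_norm integrable_cov) => // x _.
  by rewrite /= normrM (ger0_norm (sqrtr_ge0 _)).
- by move=> x Sx; rewrite mulrC ler_wpM2l// cJ.
Qed.

Hypothesis iphiA : sigma.-integrable (S : set (borel3 R)) (EFin \o (phi \o A)).

Let iphiT : sigma.-integrable (S : set (borel3 R))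
  (EFin \o (fun x => phi (A x) * T x)).
Proof.
have iG := integrableZl mS (2 * G) iphiA.
apply: le_integrable iG => //.
  apply/measurable_EFinP; apply: measurable_funM => //.
  exact: measurable_trace.
move=> x Sx; rewrite /= lee_fin !normrM mulrC ler_wpM2r//.
rewrite -normrM (ger0_norm (_ : 0 <= 2 * G)) ?mulr_ge0//.
by have [] := J_bounds Sx.
Qed.

(** Everything is reduced to the pointwise sign and size of J - (1 + t T). *)
Let first_orderE :
  \int[sigma']_(y in (A @` S : set (borel3 R))) phi y
    - \int[sigma]_(x in (S : set (borel3 R))) phi (A x)
    - t * \int[sigma]_(x in (S : set (borel3 R))) (phi (A x) * T x) =
  \int[sigma]_(x in (S : set (borel3 R)))
    (phi (A x) * (J x - (1 + t * T x))).
Proof.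
rewrite Rintegral_cov -RintegralZl// -RintegralB//; last exact: integrable_cov.
rewrite -RintegralB//.
- by apply: eq_Rintegral => x _; ring.
- exact: (integrableB mS integrable_cov iphiA).
- exact: (integrableZl mS t iphiT).
Qed.

(** The pointwise bound J >= 1 + t T is multiplied by phi >= 0. The sign of [t] is free, so that the
    reversed motion is covered. *)
Lemma first_order_lower_bound : (forall y, (A @` S) y -> 0 <= phi y) ->
  t * \int[sigma]_(x in (S : set (borel3 R))) (phi (A x) * T x) <=
  \int[sigma']_(y in (A @` S : set (borel3 R))) phi y
    - \int[sigma]_(x in (S : set (borel3 R))) phi (A x).
Proof.
move=> phi0; rewrite -subr_ge0 first_orderE; apply: Rintegral_ge0 => x Sx.
have [_ h _] := J_bounds Sx.
by rewrite mulr_ge0 ?subr_ge0//; apply: phi0; exists x.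
Qed.

Lemma first_order_error : `|t| * (2 * G) <= 2^-1 ->
  `|\int[sigma']_(y in (A @` S : set (borel3 R))) phi y
    - \int[sigma]_(x in (S : set (borel3 R))) phi (A x)
    - t * \int[sigma]_(x in (S : set (borel3 R))) (phi (A x) * T x)| <=
  t ^+ 2 * (4 * G ^+ 2) *
  \int[sigma]_(x in (S : set (borel3 R))) `|phi (A x)|.
Proof.
move=> tG; rewrite first_orderE.
have ierr : sigma.-integrable (S : set (borel3 R))
    (EFin \o (fun x => phi (A x) * (J x - (1 + t * T x)))).
  have h := integrableB mS (integrableB mS integrable_cov iphiA)
              (integrableZl mS t iphiT).
  by apply: eq_integrable h => // x _ /=; congr EFin; ring.
apply: le_trans (le_normr_Rintegral _ _) _ => //.
rewrite -RintegralZl//; last exact: (integrable_norm iphiA).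
apply: le_Rintegral => //.
- exact: (integrable_norm ierr).
- exact: (integrableZl mS _ (integrable_norm iphiA)).
move=> x Sx; have [h1 _ h3] := J_bounds Sx.
rewrite normrM mulrC ler_wpM2r// h3//.
(* This puts 1 + t T above 1/2, where the square root estimate applies. *)
have : `|t * T x| <= 2^-1.
  by rewrite normrM; apply: le_trans tG; rewrite ler_wpM2l.
by rewrite ler_norml => /andP[h _]; lra.
Qed.

Lemma area_ratio_lower_bound x : `|t| * (2 * G) <= 2^-1 -> S x -> 2^-1 <= J x.
Proof.
move=> tG Sx; have [h1 h2 _] := J_bounds Sx; apply: le_trans h2.
have : `|t * T x| <= 2^-1.
  by rewrite normrM; apply: le_trans tG; rewrite ler_wpM2l.
by rewrite ler_norml => /andP[h _]; lra.
Qed.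

End surface_integral.

(** * The moving interface *)

Lemma vertical_move_of_diffeo (R : realType) (t : R) (D : set 'rV[R]_3)
    (W : 'rV[R]_3 -> 'rV[R]_3) (w : 'rV[R]_3 -> R) :
  C1_on D W -> (forall x, D x -> W x = \row_j [:: 0; 0; w x]`_j) ->
  C1_diffeo D (ale_map W t) ->
  vertical_move t D (ale_map W t @` D) (ale_map W t) (pinv D (ale_map W t)) W.
Proof.
move=> cW hW [oD oD' iA cA cB]; split=> //.
- by move=> _ [x Dx <-]; rewrite pinvKV ?inE.
- by move=> x Dx; rewrite pinvKV ?inE.
- by move=> y D'y; rewrite pinvK ?inE.
- by move=> x Dx; rewrite hW// !mxE.
Qed.

Lemma bounded_closure_compact (R : realType) (O O' : set 'rV[R]_3) :
  bounded_set O -> O' `<=` O -> compact (closure O').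
Proof.
move=> bO O'O; apply: bounded_closed_compact; last exact: closed_closure.
move: bO; rewrite /bounded_set /bounded_near => -[M [Mr MO]].
exists M; split => // r Mr' x cx.
have cl : closed [set y : 'rV[R]_3 | `|y| <= r].
  apply: (@closed_comp _ _ _ [set z : R | z <= r]); last exact: closed_le.
  by move=> y _; exact: norm_continuous.
suff : closure [set y : 'rV[R]_3 | `|y| <= r] x.
  by rewrite -(iffLR (closure_id _) cl).
by apply: closure_subset cx => y /O'O Oy; exact: MO.
Qed.

Lemma closed_boundary (T : topologicalType) (O : set T) : closed (boundary O).
Proof.
rewrite /boundary setDE; apply: closedI; first exact: closed_closure.
by apply: open_closedC; exact: open_interior.
Qed.

Lemma boundary_open (T : topologicalType) (O : set T) :
  open O -> boundary O = closure O `\` O.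
Proof. by move=> /interior_id oO; rewrite /boundary oO. Qed.

Lemma vgrad_entry (R : realType) (W : 'rV[R]_3 -> 'rV[R]_3) x i :
  differentiable W x -> vgrad W x 0 i = 'D_(delta_mx 0 i) W x 0 2.
Proof.
by move=> dW; rewrite [LHS]mxE deriveEjacobian// -rowE [RHS]mxE.
Qed.

Lemma continuous_vgrad (R : realType) (D : set 'rV[R]_3)
    (W : 'rV[R]_3 -> 'rV[R]_3) x i : open D -> C1_on D W -> D x ->
  {for x, continuous (fun y => vgrad W y 0 i)}.
Proof.
move=> oD cW Dx.
have E : {near x, (fun y => 'D_(delta_mx 0 i) W y 0 2) =1
                  (fun y => vgrad W y 0 i)}.
  near=> y; rewrite vgrad_entry//.
  have Dy : D y by near: y; exact: open_nbhs_nbhs.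
  by have [] := cW _ Dy.
suff key l : l = 'D_(delta_mx 0 i) W x 0 2 ->
    (fun y => vgrad W y 0 i) @ x --> l.
  by apply: key; apply: vgrad_entry; have [] := cW _ Dx.
move=> ->; apply: cvg_trans (near_eq_cvg E) _.
apply: (cvg_comp _ (fun M : 'rV[R]_3 => M 0 2) ((cW _ Dx).2 _)).
exact: coord_continuous.
Unshelve. all: by end_near. Qed.

Lemma vgrad_bounded (R : realType) (D S : set 'rV[R]_3)
    (W : 'rV[R]_3 -> 'rV[R]_3) : open D -> C1_on D W -> compact S -> S `<=` D ->
  exists2 G, 0 <= G & forall x, S x -> dot (vgrad W x) (vgrad W x) <= G ^+ 2.
Proof.
move=> oD cW cS SD; have [->|/set0P S0] := eqVneq S set0; first by exists 0.
have [|c Sc cmax] :=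
  @compact_EVT_max _ R (fun x => dot (vgrad W x) (vgrad W x)) _ S0 cS.
  apply: within_continuous_in => x /SD Dx.
  by apply: (@continuous_dot _ _ (vgrad W) (vgrad W)) => i;
    exact: continuous_vgrad oD cW Dx.
exists (Num.sqrt (dot (vgrad W c) (vgrad W c))); first exact: sqrtr_ge0.
by move=> x /mem_set Sx; rewrite (sqr_sqrtr (dot_ge0 _)); exact: cmax x Sx.
Qed.

(** Squares are minimized because 1 + t g_3 may change sign from one component of [S] to another. *)
Lemma vertical_jacobian_bounded (R : realType) (D S : set 'rV[R]_3)
    (W : 'rV[R]_3 -> 'rV[R]_3) (t : R) : open D -> C1_on D W -> compact S ->
  S `<=` D -> (forall x, D x -> 1 + t * vgrad W x 0 2 != 0) ->
  exists2 c, 0 < c & forall x, S x -> c ^+ 2 <= (1 + t * vgrad W x 0 2) ^+ 2.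
Proof.
move=> oD cW cS SD tN0; have [->|/set0P S0] := eqVneq S set0; first by exists 1.
have [|c Sc cmin] :=
  @compact_EVT_min _ R (fun x => (1 + t * vgrad W x 0 2) ^+ 2) _ S0 cS.
  apply: within_continuous_in => x /SD Dx.
  have cv : {for x, continuous (fun y => vgrad W y 0 2)}.
    exact: continuous_vgrad oD cW Dx.
  have cj : {for vgrad W x 0 2, continuous (fun z : R => (1 + t * z) ^+ 2)}.
    have cz : {for vgrad W x 0 2, continuous (fun z : R => 1 + t * z)}.
      apply: cvgD; first exact: cvg_cst.
      by apply: cvgM; [exact: cvg_cst|exact: cvg_id].
    exact: (cvgM cz cz).
  exact: (continuous_comp cv cj).
exists `|1 + t * vgrad W c 0 2|.
  by rewrite normr_gt0; apply/tN0/SD/set_mem.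
by move=> x /mem_set Sx; rewrite (real_normK (num_real _)); exact: cmin x Sx.
Qed.

(** * Image of the interface, and the gradient of the transported velocity *)

Section move_topology.
Context (R : realType) (t : R) (D D' : set 'rV[R]_3).
Context (A B W : 'rV[R]_3 -> 'rV[R]_3).
Hypothesis AW : vertical_move t D D' A B W.

Let inj x y : D x -> D y -> A x = A y -> x = y.
Proof. by move=> Dx Dy /(congr1 B); rewrite !(vm_funK AW). Qed.

(** [A] is a homeomorphism only from [D] to [D'], while boundaries are taken in the whole space.
    Compactness makes the image of [closure O] closed, so the closure of the image acquires no
    further points. *)
Lemma move_boundary (O : set 'rV[R]_3) : open O -> compact (closure O) ->
  closure O `<=` D -> boundary (A @` O) = A @` boundary O.
Proof.
move=> oO cO cOD.
have OD x : O x -> D x by move=> Ox; exact/cOD/subset_closure.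
have oA : open (A @` O).
  have -> : A @` O = D' `&` B @^-1` O.
    apply/seteqP; split=> [_ [x Ox <-]|y [D'y By]].
      split; first exact/(vm_fun AW)/OD.
      by rewrite /preimage/= (vm_funK AW)//; exact: OD.
    by exists (B y) => //; exact: vm_invK AW _ D'y.
  exact: C1_on_open_preimage (vm_openr AW) (vm_invC1 AW) oO.
have clA : closure (A @` O) = A @` closure O.
  apply/seteqP; split.
    have cl : closed (A @` closure O).
      apply: compact_closed; first exact: norm_hausdorff.
      apply: continuous_compact cO; apply: within_continuous_in => x /cOD Dx.
      exact: C1_on_continuous (vm_funC1 AW) Dx.
    rewrite [X in _ `<=` X](iffLR (closure_id _) cl).
    by apply/closure_subset/image_subset; exact: subset_closure.
  move=> _ [x cx <-] V nV.
  have cA : {for x, continuous A}.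
    exact: C1_on_continuous (vm_funC1 AW) (cOD _ cx).
  have [y [Oy Vy]] := cx _ (cA _ nV).
  by exists (A y); split => //; exists y.
rewrite !boundary_open// clA; apply/seteqP; split.
  move=> _ [[x cx <-] nO]; exists x => //.
  by split => // Ox; apply: nO; exists x.
move=> _ [x [cx nO] <-]; split; first by exists x.
move=> [y Oy /(inj (OD _ Oy) (cOD _ cx)) yx].
by apply: nO; rewrite -yx.
Qed.

Lemma move_interface (O1 O2 : set 'rV[R]_3) : open O1 -> open O2 ->
  compact (closure O1) -> compact (closure O2) ->
  closure O1 `<=` D -> closure O2 `<=` D ->
  interface (A @` O1) (A @` O2) = A @` interface O1 O2.
Proof.
move=> o1 o2 c1 c2 d1 d2; rewrite /interface !move_boundary//.
apply/seteqP; split; last first.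
  by move=> _ [x [b1 b2] <-]; split; exists x.
move=> _ [[x b1 <-] [y b2 /inj yx]]; exists x => //; split => //.
by rewrite -yx//; [apply: d2; case: b2|apply: d1; case: b1].
Qed.

Lemma move_smooth (S : set 'rV[R]_3) : S `<=` D -> smooth_hypersurface S ->
  smooth_hypersurface (A @` S).
Proof.
move=> SD sS _ [x Sx <-]; have [H [U [V [psi [psiP Vx]]]]] := sS _ Sx.
exists H, (U `&` psi @^-1` D), (D' `&` B @^-1` V), (A \o psi).
split; first by have [] := is_chart_move AW SD psiP.
split; first exact/(vm_fun AW)/SD.
by rewrite /preimage/= (vm_funK AW)//; exact: SD.
Qed.

(* Compare the third components in d(B o A) = id. *)
Lemma vgrad_reversed x i : t != 0 -> D x ->
  vgrad W x 0 i =
  vgrad (W \o B) (A x) 0 i + t * vgrad W x 0 i * vgrad (W \o B) (A x) 0 2.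
Proof.
move=> t0 Dx.
have := derive_inv_move AW (delta_mx 0 i) Dx.
have D'x := vm_fun AW Dx.
rewrite (derive_move (vertical_move_sym AW) _ D'x).
move: (vgrad W x) (vgrad (W \o B) (A x)) => g h.
have dE (u v : 'rV[R]_3) k :
    dot (u + k *: delta_mx 0 2) v = dot u v + k * v 0 2.
  rewrite !dotE !mxE /=; ring.
have de k : dot (delta_mx 0 i) k = k 0 i.
  rewrite /dot mxE (bigD1 i)//= big1 ?addr0 => [|j ji].
    by rewrite !mxE !eqxx mul1r.
  by rewrite mxE (negbTE ji) mul0r.
rewrite /shear dE !de -addrA -scalerDl => /eqP.
rewrite addrC -subr_eq0 addrK scaler_eq0 => /orP[/eqP e|/eqP/rowP/(_ 2)].
  apply: (mulfI t0); lra.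
by rewrite !mxE !eqxx => /eqP; rewrite oner_eq0.
Qed.

(** A bound on the transported gradient h that is uniform in t. By [vgrad_reversed], h = (1 - t h_3)
    g and t h_3 = t g_3 / (1 + t g_3), which is at most (1/4) / (3/4) = 1/3 in absolute value; hence
    |1 - t h_3| <= 2. *)
Lemma vgrad_reversed_bound G x : 0 < t -> 0 <= G -> t * G <= 4^-1 -> D x ->
  dot (vgrad W x) (vgrad W x) <= G ^+ 2 ->
  dot (vgrad (W \o B) (A x)) (vgrad (W \o B) (A x)) <= (2 * G) ^+ 2.
Proof.
move=> t0 G0 tG Dx gG.
have E i := vgrad_reversed i (lt0r_neq0 t0) Dx.
move: (vgrad W x) (vgrad (W \o B) (A x)) E gG => g k E.
move: (E 0) (E 1) (E 2); rewrite !dotE.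
move: (g 0 0) (g 0 1) (g 0 2) (k 0 0) (k 0 1) (k 0 2) => g0 g1 g2 h0 h1 h2.
move=> E0 E1 E2 gG.
have g2G : `|g2| <= G.
  rewrite -ler_sqr ?nnegrE// real_normK ?num_real//; apply: le_trans gG.
  by rewrite -!expr2 lerDr addr_ge0// sqr_ge0.
have tg2 : `|t * g2| <= 4^-1.
  rewrite normrM gtr0_norm//; apply: le_trans tG.
  by rewrite (ler_wpM2l (ltW t0)).
have th2 : `|t * h2| <= 3^-1.
  have e : t * g2 = t * h2 * (1 + t * g2) by rewrite {1}E2; ring.
  have h : `|t * h2| * `|1 + t * g2| <= 4^-1 by rewrite -normrM -e.
  have : 3 / 4 <= `|1 + t * g2|.
    apply: le_trans (ler_norm _).
    by move: tg2; rewrite ler_norml => /andP[? ?]; lra.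
  have := normr_ge0 (t * h2); move: h.
  move: `|t * h2| `|1 + t * g2| => a b ab a0 b4.
  suff : a * (3 / 4) <= 4^-1 by lra.
  by apply: le_trans ab; rewrite ler_wpM2l.
have sq : (1 - t * h2) ^+ 2 <= 2 ^+ 2.
  move: th2; rewrite ler_norml => /andP[? ?].
  by rewrite ler_sqr ?nnegrE; lra.
have e a b : a = b + t * a * h2 -> b = a * (1 - t * h2).
  by move=> eg; transitivity (a - t * a * h2); [rewrite {1}eg|]; ring.
have -> : h0 * h0 + h1 * h1 + h2 * h2 =
    (1 - t * h2) ^+ 2 * (g0 * g0 + g1 * g1 + g2 * g2).
  transitivity ((g0 * (1 - t * h2)) ^+ 2 + (g1 * (1 - t * h2)) ^+ 2
    + (g2 * (1 - t * h2)) ^+ 2); last by ring.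
  by rewrite -(e _ _ E0) -(e _ _ E1) -(e _ _ E2) -!expr2.
by rewrite exprMn ler_pM ?sqr_ge0// -!expr2 !addr_ge0// sqr_ge0.
Qed.

End move_topology.

(** * The two inequalities and their errors on a compact surface *)

Section moving_surface.
Context (R : realType) (t : R) (D D' : set 'rV[R]_3).
Context (A B W : 'rV[R]_3 -> 'rV[R]_3).
Hypothesis AW : vertical_move t D D' A B W.
Context (S : set 'rV[R]_3).
Hypotheses (SD : S `<=` D) (cS : compact S) (sS : smooth_hypersurface S).
Context (sigma sigma' : {measure set (borel3 R) -> \bar R}).
Hypotheses (sigmaP : surface_measure S sigma)
  (sigmaP' : surface_measure (A @` S) sigma').
Context (phi : 'rV[R]_3 -> R).
Hypothesis iphi : sigma'.-integrable (A @` S : set (borel3 R)) (EFin \o phi).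

Section source_normal.
Context (n : 'rV[R]_3 -> 'rV[R]_3) (nS : unit_normal S n).

Lemma integrable_comp_move :
  sigma.-integrable (S : set (borel3 R)) (EFin \o (phi \o A)).
Proof.
have [G G0 gG] := vgrad_bounded (vm_openl AW) (vm_velC1 AW) cS SD.
have [c c0 hc] := vertical_jacobian_bounded (vm_openl AW) (vm_velC1 AW) cS SD
  (fun x => vertical_jacobian_neq0 AW (x := x)).
have k0 : 0 < 2 + 2 * t ^+ 2 * G ^+ 2.
  by rewrite ltr_wpDr// -mulrA mulr_ge0// -exprMn sqr_ge0.
(* The lower bound on J given by [conormal_lower_bound], valid without smallness of [t]. *)
pose e := Num.sqrt (c ^+ 2 / (2 + 2 * t ^+ 2 * G ^+ 2)).
have e0 : 0 < e by rewrite sqrtr_gt0 divr_gt0// exprn_gt0.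
have [] := integrable_pullback AW SD cS sS nS sigmaP sigmaP' iphi e0 _ => //.
move=> x Sx; rewrite ler_sqrt ?dot_ge0// ler_pdivrMr// mulrC.
exact: conormal_lower_bound (nS.1 _ Sx) (gG _ Sx) (hc _ Sx).
Qed.

Lemma surface_integral_lower_bound : (forall y, (A @` S) y -> 0 <= phi y) ->
  t * \int[sigma]_(x in (S : set (borel3 R)))
        (phi (A x) * \tr (surface_gradient n W x)) <=
  \int[sigma']_(y in (A @` S : set (borel3 R))) phi y
    - \int[sigma]_(x in (S : set (borel3 R))) phi (A x).
Proof.
have [G G0 gG] := vgrad_bounded (vm_openl AW) (vm_velC1 AW) cS SD.
by have := first_order_lower_bound AW SD cS sS nS sigmaP sigmaP' G0 gG iphi
  integrable_comp_move.
Qed.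

Lemma surface_integral_lower_error (G : R) : 0 <= G ->
  (forall x, S x -> dot (vgrad W x) (vgrad W x) <= G ^+ 2) ->
  `|t| * (2 * G) <= 2^-1 ->
  `|\int[sigma']_(y in (A @` S : set (borel3 R))) phi y
    - \int[sigma]_(x in (S : set (borel3 R))) phi (A x)
    - t * \int[sigma]_(x in (S : set (borel3 R)))
            (phi (A x) * \tr (surface_gradient n W x))| <=
  8 * G ^+ 2 * t ^+ 2 *
  \int[sigma']_(y in (A @` S : set (borel3 R))) `|phi y|.
Proof.
move=> G0 gG tG.
have Jlow x : S x -> 2^-1 <= area_ratio t W n x.
  exact: (area_ratio_lower_bound AW SD nS G0 gG tG).
have [_ h] := integrable_pullback AW SD cS sS nS sigmaP sigmaP' iphi
  (ltac:(by []) : (0 : R) < 2^-1) Jlow.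
apply: le_trans (first_order_error AW SD cS sS nS sigmaP sigmaP' G0 gG iphi
  integrable_comp_move tG) _.
rewrite (_ : 8 * G ^+ 2 * t ^+ 2 = t ^+ 2 * (4 * G ^+ 2) * 2); last by ring.
rewrite -[leRHS]mulrA; apply: ler_wpM2l; last by rewrite -ler_pdivrMl.
by rewrite mulr_ge0 ?sqr_ge0// mulr_ge0 ?sqr_ge0.
Qed.

End source_normal.

Section target_normal.
Context (n' : 'rV[R]_3 -> 'rV[R]_3) (nS' : unit_normal (A @` S) n').
Hypothesis iphiA : sigma.-integrable (S : set (borel3 R)) (EFin \o (phi \o A)).

(** The reversed motion starts from [S'] and transports the function [phi \o A], whose pullback by
    [B] is [phi] on [S']. *)
Let BW := vertical_move_sym AW.
Let S' := A @` S.
Let S'D' : S' `<=` D'.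
Proof. by move=> _ [x /SD Dx <-]; exact: vm_fun AW _ Dx. Qed.
Let cS' : compact S'. Proof. exact: (move_image_compact AW). Qed.
Let sS' : smooth_hypersurface S'. Proof. exact: (move_smooth AW). Qed.
Let BS' : B @` S' = S.
Proof.
apply/seteqP; split=> [_ [_ [x Sx <-] <-]|x Sx].
  by rewrite (vm_funK AW)//; exact: SD.
by exists (A x); [exists x|rewrite (vm_funK AW)//; exact: SD].
Qed.
Let sigmaB : surface_measure (B @` S') sigma. Proof. by rewrite BS'. Qed.
Let ABK y : S' y -> A (B y) = y.
Proof. by move=> /S'D' D'y; exact: vm_invK AW _ D'y. Qed.
Let iphiB : sigma.-integrable (B @` S' : set (borel3 R)) (EFin \o (phi \o A)).
Proof. by rewrite BS'. Qed.
Let iphiAB : sigma'.-integrable (S' : set (borel3 R))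
  (EFin \o ((phi \o A) \o B)).
Proof.
apply: eq_integrable iphi; first exact: compact_borel3.
by move=> y /[!inE] S'y; rewrite /= ABK.
Qed.

Let integralAB (F : 'rV[R]_3 -> R) :
  \int[sigma']_(y in (S' : set (borel3 R))) (phi (A (B y)) * F y) =
  \int[sigma']_(y in (S' : set (borel3 R))) (phi y * F y).
Proof. by apply: eq_Rintegral => y /[!inE] S'y; rewrite ABK. Qed.

Let integralAB1 :
  \int[sigma']_(y in (S' : set (borel3 R))) phi (A (B y)) =
  \int[sigma']_(y in (S' : set (borel3 R))) phi y.
Proof. by apply: eq_Rintegral => y /[!inE] S'y; rewrite ABK. Qed.

Let integralAB_norm :
  \int[sigma']_(y in (S' : set (borel3 R))) `|phi (A (B y))| =
  \int[sigma']_(y in (S' : set (borel3 R))) `|phi y|.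
Proof. by apply: eq_Rintegral => y /[!inE] S'y; rewrite ABK. Qed.

Lemma surface_integral_upper_bound : (forall y, (A @` S) y -> 0 <= phi y) ->
  \int[sigma']_(y in (A @` S : set (borel3 R))) phi y
    - \int[sigma]_(x in (S : set (borel3 R))) phi (A x) <=
  t * \int[sigma']_(y in (A @` S : set (borel3 R)))
        (phi y * \tr (surface_gradient n' (W \o B) y)).
Proof.
move=> phi0.
have [G G0 gG] := vgrad_bounded (vm_openl BW) (vm_velC1 BW) cS' S'D'.
have phiA0 x : (B @` S') x -> 0 <= (phi \o A) x.
  by rewrite BS' => Sx; apply: phi0; exists x.
have := first_order_lower_bound BW S'D' cS' sS' nS' sigmaP' sigmaB G0 gG iphiB
  iphiAB phiA0.
rewrite /= integralAB integralAB1 BS' mulNr => h.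
by rewrite -lerN2 opprB.
Qed.

(** Here the constant stays 4: the reversed motion starts from [S'], where the norm of phi is
    already taken. *)
Lemma surface_integral_upper_error (G : R) : 0 <= G ->
  (forall y, S' y -> dot (vgrad (W \o B) y) (vgrad (W \o B) y) <= G ^+ 2) ->
  `|t| * (2 * G) <= 2^-1 ->
  `|t * \int[sigma']_(y in (A @` S : set (borel3 R)))
        (phi y * \tr (surface_gradient n' (W \o B) y)) -
    (\int[sigma']_(y in (A @` S : set (borel3 R))) phi y
    - \int[sigma]_(x in (S : set (borel3 R))) phi (A x))| <=
  4 * G ^+ 2 * t ^+ 2 *
  \int[sigma']_(y in (A @` S : set (borel3 R))) `|phi y|.
Proof.
move=> G0 gG tG.
have tG' : `|- t| * (2 * G) <= 2^-1 by rewrite normrN.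
have := first_order_error BW S'D' cS' sS' nS' sigmaP' sigmaB G0 gG iphiB
  iphiAB tG'.
rewrite /= integralAB integralAB1 integralAB_norm BS' mulNr sqrrN => h.
rewrite (_ : 4 * G ^+ 2 * t ^+ 2 = t ^+ 2 * (4 * G ^+ 2)); last by ring.
by apply: le_trans h; rewrite opprB opprK addrC.
Qed.

End target_normal.
End moving_surface.

Unset Implicit Arguments.

(** In (3) the new interface moves with [dt], so [phi], [sigma'] and [n'] are families indexed by
    [dt]; the bounded L^1 norm of [phi dt] makes the constant uniform. *)
Theorem lemma4 (R : realType) (Omega Omega1 Omega2 D : set 'rV[R]_3)
    (W : 'rV[R]_3 -> 'rV[R]_3) (w : 'rV[R]_3 -> R)
    (n : 'rV[R]_3 -> 'rV[R]_3) (sigma : {measure set (borel3 R) -> \bar R})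
    (hOmega : bounded_smooth_domain Omega)
    (hOmega1 : open Omega1 /\ Omega1 `<=` Omega)
    (hOmega2 : open Omega2 /\ Omega2 `<=` Omega)
    (hdisj : Omega1 `&` Omega2 = set0)
    (hD : open D /\ closure Omega `<=` D)
    (hWC1 : C1_on D W)
    (hW : forall x, D x -> W x = \row_j [:: 0; 0; w x]`_j)
    (hSigma : smooth_hypersurface (interface Omega1 Omega2))
    (hn : unit_normal (interface Omega1 Omega2) n)
    (hsigma : surface_measure (interface Omega1 Omega2) sigma) :
  [/\ (* (1) *)
    forall (dt : R) (phi : 'rV[R]_3 -> R)
        (sigma' : {measure set (borel3 R) -> \bar R}),
      0 < dt -> C1_diffeo D (ale_map W dt) ->
      surface_measure (next_interface Omega1 Omega2 W dt) sigma' ->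
      sigma'.-integrable (next_interface Omega1 Omega2 W dt) (EFin \o phi) ->
      (forall y, next_interface Omega1 Omega2 W dt y -> 0 <= phi y) ->
      (forall x, interface Omega1 Omega2 x ->
        0 <= 1 + dt * \tr (surface_gradient n W x)) ->
      \int[sigma']_(y in next_interface Omega1 Omega2 W dt) phi y
        - \int[sigma]_(x in interface Omega1 Omega2) phi (ale_map W dt x)
      >= dt * \int[sigma]_(x in interface Omega1 Omega2)
                (phi (ale_map W dt x) * \tr (surface_gradient n W x)),
    (* (2) *)
    forall (dt : R) (phi : 'rV[R]_3 -> R)
        (sigma' : {measure set (borel3 R) -> \bar R})
        (n' : 'rV[R]_3 -> 'rV[R]_3),
      0 < dt -> C1_diffeo D (ale_map W dt) ->
      surface_measure (next_interface Omega1 Omega2 W dt) sigma' ->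
      unit_normal (next_interface Omega1 Omega2 W dt) n' ->
      sigma'.-integrable (next_interface Omega1 Omega2 W dt) (EFin \o phi) ->
      (forall y, next_interface Omega1 Omega2 W dt y -> 0 <= phi y) ->
      (forall y, next_interface Omega1 Omega2 W dt y ->
        0 <= 1 - dt * \tr (surface_gradient n' (transported_velocity D W dt) y)) ->
      \int[sigma']_(y in next_interface Omega1 Omega2 W dt) phi y
        - \int[sigma]_(x in interface Omega1 Omega2) phi (ale_map W dt x)
      <= dt * \int[sigma']_(y in next_interface Omega1 Omega2 W dt)
                (phi y * \tr (surface_gradient n' (transported_velocity D W dt) y))
  & (* (3) *)
    forall (phi : R -> 'rV[R]_3 -> R)
        (sigma' : R -> {measure set (borel3 R) -> \bar R})
        (n' : R -> 'rV[R]_3 -> 'rV[R]_3),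
      (\forall dt \near 0^'+, C1_diffeo D (ale_map W dt)) ->
      (\forall dt \near 0^'+,
         surface_measure (next_interface Omega1 Omega2 W dt) (sigma' dt)) ->
      (\forall dt \near 0^'+,
         unit_normal (next_interface Omega1 Omega2 W dt) (n' dt)) ->
      (\forall dt \near 0^'+,
         (sigma' dt).-integrable (next_interface Omega1 Omega2 W dt)
           (EFin \o phi dt)) ->
      (fun dt : R => \int[sigma' dt]_(y in next_interface Omega1 Omega2 W dt)
                       `|phi dt y|)
        =O_ (0^'+) (fun _ : R => 1 : R) ->
      (fun dt : R =>
         (\int[sigma' dt]_(y in next_interface Omega1 Omega2 W dt) phi dt y
          - \int[sigma]_(x in interface Omega1 Omega2) phi dt (ale_map W dt x))
         - dt * \int[sigma]_(x in interface Omega1 Omega2)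
             (phi dt (ale_map W dt x) * \tr (surface_gradient n W x)))
        =O_ (0^'+) (fun dt : R => dt ^+ 2) /\
      (fun dt : R =>
         dt * \int[sigma' dt]_(y in next_interface Omega1 Omega2 W dt)
           (phi dt y *
            \tr (surface_gradient (n' dt) (transported_velocity D W dt) y))
         - (\int[sigma' dt]_(y in next_interface Omega1 Omega2 W dt) phi dt y
            - \int[sigma]_(x in interface Omega1 Omega2)
                phi dt (ale_map W dt x)))
        =O_ (0^'+) (fun dt : R => dt ^+ 2) ].
Proof.
have [_ _ bOmega _] := hOmega.
have [oO1 sO1] := hOmega1; have [oO2 sO2] := hOmega2; have [oD cOD] := hD.
have c1 := bounded_closure_compact bOmega sO1.
have c2 := bounded_closure_compact bOmega sO2.
have d1 : closure Omega1 `<=` D by exact: subset_trans (closure_subset sO1) cOD.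
have d2 : closure Omega2 `<=` D by exact: subset_trans (closure_subset sO2) cOD.
set S := interface Omega1 Omega2 in hSigma hn hsigma *.
have SD : S `<=` D by move=> x [[cx _] _]; exact: d1.
have cS : compact S.
  apply: (subclosed_compact _ c1).
    by apply: closedI; exact: closed_boundary.
  by move=> x [[]].
have move_ale dt : C1_diffeo D (ale_map W dt) ->
    vertical_move dt D (ale_map W dt @` D) (ale_map W dt)
      (pinv D (ale_map W dt)) W /\
    next_interface Omega1 Omega2 W dt = ale_map W dt @` S.
  move=> diffeo; have AW := vertical_move_of_diffeo hWC1 hW diffeo.
  by split => //; exact: (move_interface AW).
split.
- move=> dt phi sigma' _ /move_ale[AW ->] hsigma' iphi phi0 _.
  exact: (surface_integral_lower_bound AW SD cS hSigma hsigma hsigma' iphi hn).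
- move=> dt phi sigma' n' _ /move_ale[AW ->] hsigma' hn' iphi phi0 _.
  have iphiA := integrable_comp_move AW SD cS hSigma hsigma hsigma' iphi hn.
  exact: (surface_integral_upper_bound AW SD cS hSigma hsigma hsigma' iphi
    hn' iphiA).
- move=> phi sigma' n' hdiff hsigma' hn' hiphi /eqO_exP[M M0 hM].
  have [G G0 gG] := vgrad_bounded oD hWC1 cS SD.
  (* [G + 1] can be divided by even if [G] is 0. The value 1/8 comes from the reversed motion: its
     gradient bound 2 G requires 4 G dt <= 1/2. *)
  have small : \forall dt \near 0^'+, 0 < dt /\ dt * (G + 1) <= 8^-1.
    near=> dt; split; first by near: dt; exact: nbhs_right_gt.
    rewrite -ler_pdivlMr ?ltr_wpDl//; apply: ltW; near: dt.
    by apply: nbhs_right_lt; rewrite divr_gt0// ltr_wpDl.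
  have tG dt : 0 < dt /\ dt * (G + 1) <= 8^-1 -> dt * G <= 8^-1.
    by move=> [dt0]; apply: le_trans; rewrite ler_pM2l// lerDl.
  split; apply/eqO_exP.
  (* The added 1 keeps the constant positive when [G] is 0. *)
  + exists (8 * G ^+ 2 * M + 1).
      by rewrite ltr_wpDl// !mulr_ge0// ?sqr_ge0// ltW.
    near=> dt.
    have [] : 0 < dt /\ dt * (G + 1) <= 8^-1 by near: dt.
    move=> dt0 /(conj dt0)/tG dtG.
    have /move_ale[AW E] : C1_diffeo D (ale_map W dt) by near: dt.
    have hs : surface_measure (next_interface Omega1 Omega2 W dt) (sigma' dt).
      by near: dt.
    have hi : (sigma' dt).-integrable (next_interface Omega1 Omega2 W dt)
        (EFin \o phi dt) by near: dt.
    have hMdt : `|\int[sigma' dt]_(y in next_interface Omega1 Omega2 W dt)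
        `|phi dt y| | <= M * `|1| by near: dt.
    rewrite E in hs hi hMdt *.
    have tG2 : `|dt| * (2 * G) <= 2^-1 by rewrite gtr0_norm//; lra.
    apply: le_trans (surface_integral_lower_error AW SD cS hSigma hsigma hs hi
      hn G0 gG tG2) _.
    rewrite (ger0_norm (sqr_ge0 _)).
    move: hMdt; rewrite normr1 mulr1 => /(le_trans (ler_norm _)) hMdt.
    apply: (@le_trans _ _ (8 * G ^+ 2 * dt ^+ 2 * M)).
      by rewrite ler_wpM2l// !mulr_ge0// sqr_ge0.
    by have := sqr_ge0 dt; lra.
  (* 16 G^2 is 4 (2 G)^2, with 2 G the bound on the transported gradient. *)
  + exists (16 * G ^+ 2 * M + 1).
      by rewrite ltr_wpDl// !mulr_ge0// ?sqr_ge0// ltW.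
    near=> dt.
    have [] : 0 < dt /\ dt * (G + 1) <= 8^-1 by near: dt.
    move=> dt0 /(conj dt0)/tG dtG.
    have /move_ale[AW E] : C1_diffeo D (ale_map W dt) by near: dt.
    have hs : surface_measure (next_interface Omega1 Omega2 W dt) (sigma' dt).
      by near: dt.
    have hn't : unit_normal (next_interface Omega1 Omega2 W dt) (n' dt).
      by near: dt.
    have hi : (sigma' dt).-integrable (next_interface Omega1 Omega2 W dt)
        (EFin \o phi dt) by near: dt.
    have hMdt : `|\int[sigma' dt]_(y in next_interface Omega1 Omega2 W dt)
        `|phi dt y| | <= M * `|1| by near: dt.
    rewrite E in hs hi hMdt hn't *.
    have iphiA := integrable_comp_move AW SD cS hSigma hsigma hs hi hn.
    have tG2 : `|dt| * (2 * (2 * G)) <= 2^-1 by rewrite gtr0_norm//; lra.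
    have tG4 : dt * G <= 4^-1 by lra.
    have gG' y : (ale_map W dt @` S) y ->
        dot (vgrad (W \o pinv D (ale_map W dt)) y)
            (vgrad (W \o pinv D (ale_map W dt)) y) <= (2 * G) ^+ 2.
      move=> [x Sx <-].
      exact: (vgrad_reversed_bound AW dt0 G0 tG4 (SD _ Sx) (gG _ Sx)).
    apply: le_trans (surface_integral_upper_error AW SD cS hSigma hsigma hs hi
      hn't iphiA (mulr_ge0 _ G0) gG' tG2) _ => //.
    rewrite (ger0_norm (sqr_ge0 _)).
    move: hMdt; rewrite normr1 mulr1 => /(le_trans (ler_norm _)) hMdt.
    apply: (@le_trans _ _ (4 * (2 * G) ^+ 2 * dt ^+ 2 * M)).
      by rewrite ler_wpM2l// !mulr_ge0// sqr_ge0.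
    rewrite (_ : 4 * (2 * G) ^+ 2 = 16 * G ^+ 2); last by ring.
    by have := sqr_ge0 dt; lra.
Unshelve. all: by end_near. Qed.
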